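(* Fix integers $d\ge 1$ and $k\ge 3$. For each prime power $q$, let $Q$ be a non-degenerate quadratic form on $\mathbb{F}_q^d$, let $\mathcal{V}\subset\mathbb{F}_q^d$ be a regular variety, and let $\mathcal{E}\subseteq\mathcal{V}$. If $q^{\frac{d-1}{2}+\frac{1}{k-1}}=o(|\mathcal{E}|)$, then for every $t\in\mathbb{F}_q^*=\mathbb{F}_q\setminus\{0\}$, \[\left|\left\{(\mathbf{x}_1,\ldots,\mathbf{x}_k)\in\mathcal{E}^k : Q(\mathbf{x}_1+\cdots+\mathbf{x}_k)=t\right\}\right|=(1-o(1))\frac{|\mathcal{E}|^k}{q}.\]
   Context: Let $\chi$ be a fixed nontrivial additive character of $\mathbb{F}_q$. For $\mathcal{V}\subseteq\mathbb{F}_q^d$ with characteristic function $\mathbf{1}_\mathcal{V}$, its Fourier transform is $\widehat{\mathbf{1}_\mathcal{V}}(\mathbf{m})=q^{-d}\sum_{\mathbf{x}\in\mathbb{F}_q^d}\chi(-\mathbf{m}\cdot\mathbf{x})\mathbf{1}_\mathcal{V}(\mathbf{x})$. A variety $\mathcal{V}=\{\mathbf{x}\in\mathbb{F}_q^d : F(\mathbf{x})=0\}$ for a polynomial $F\in\mathbb{F}_q[x_1,\ldots,x_d]$ is called regular if $|\mathcal{V}|\asymp q^{d-1}$ and $|\widehat{\mathbf{1}_\mathcal{V}}(\mathbf{m})|\ll q^{-(d+1)/2}$ for all $\mathbf{m}\in\mathbb{F}_q^d\setminus\{\mathbf{0}\}$. Asymptotic conventions: all objects depend on $q$, with $d,k$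 fixed; $X\asymp Y$ means $C_1Y<X<C_2Y$ and $X\ll Y$ means $X\le CY$ for positive constants independent of $q$; $X=o(Y)$ means $X/Y\to 0$ as $q\to\infty$. *)

(* Defs.v *)
From mathcomp Require Import all_boot all_order all_algebra.
From mathcomp Require Import all_classical all_reals all_analysis.
From mathcomp Require Export complex.
(* Not imported: its notations clash with those of the analysis library. *)
From mathcomp Require mpoly.

Set Implicit Arguments.
Unset Strict Implicit.
Unset Printing Implicit Defensive.

Import Order.TTheory GRing.Theory Num.Theory.
Import numFieldNormedType.Exports.

Local Open Scope ring_scope.
Local Open Scope complex_scope.

Definition prime_power (q : nat) : Prop :=
  exists p n : nat, [/\ prime p, (0 < n)%N & q = (p ^ n)%N].

(* The filter "q tends to infinity along the prime powers". *)
Definition prime_power_oo : set_system nat := within prime_power \oo%classic.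

#[global] Instance prime_power_oo_filter : Filter prime_power_oo :=
  within_filter prime_power eventually_filter.

(* Needed by the notation f =o_prime_power_oo g. *)
Canonical prime_power_oo_filter_on : filter_on nat :=
  FilterType prime_power_oo prime_power_oo_filter.

Section FiniteField.
Variables (F : finFieldType) (d : nat).

Definition dotp (x y : 'rV[F]_d) : F := \sum_(i < d) x 0 i * y 0 i.

Definition is_variety (V : {set 'rV[F]_d}) : Prop :=
  exists P : mpoly.mpoly d F,
    forall x, (x \in V) = (mpoly.meval (fun i => x 0 i) P == 0).

Definition polar (Q : 'rV[F]_d -> F) (x y : 'rV[F]_d) : F :=
  Q (x + y) - Q x - Q y.

(* The polar form is symmetric, so linearity in one argument is bilinearity. *)
Definition is_quadratic_form (Q : 'rV[F]_d -> F) : Prop :=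
  (forall a x, Q (a *: x) = a ^+ 2 * Q x) /\
  (forall y, scalar (fun x => polar Q x y)).

(* In odd characteristic Q x = polar Q x x / 2, so the hypothesis Q x = 0 is
   automatic and this says that the polar form is non-degenerate.  In
   characteristic 2 it is the usual notion, which for d odd is the only
   satisfiable one (the polar form is then alternating, hence degenerate). *)
Definition nondegenerate_quadratic_form (Q : 'rV[F]_d -> F) : Prop :=
  is_quadratic_form Q /\
  (forall x, (forall y, polar Q x y = 0) -> Q x = 0 -> x = 0).

Definition sum_solutions (k : nat) (Q : 'rV[F]_d -> F) (E : {set 'rV[F]_d})
    (t : F) : {set {ffun 'I_k -> 'rV[F]_d}} :=
  [set x : {ffun 'I_k -> 'rV[F]_d}
    | [forall i, x i \in E] && (Q (\sum_i x i) == t)]%SET.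

Variable R : realType.

Definition nontrivial_additive_character (chi : F -> R[i]) : Prop :=
  [/\ chi 0 = 1, forall x y, chi (x + y) = chi x * chi y
    & exists x, chi x != 1].

Definition fourier_indicator (chi : F -> R[i]) (V : {set 'rV[F]_d})
    (m : 'rV[F]_d) : R[i] :=
  (#|F|%:R ^+ d)^-1 * \sum_x chi (- dotp m x) * (x \in V)%:R.

End FiniteField.

(* Regularity is a property of the family (V q), indexed by the prime powers:
   the constants C1, C2, C do not depend on q. *)
Definition regular_varieties (R : realType) (d : nat) (F : nat -> finFieldType)
    (chi : forall q, F q -> R[i]) (V : forall q, {set 'rV[F q]_d}) : Prop :=
  [/\ forall q, prime_power q -> is_variety (V q),
      exists C1 C2 : R, [/\ 0 < C1, 0 < C2 & forall q, prime_power q ->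
        C1 * q%:R `^ (d%:R - 1) < #|V q|%:R < C2 * q%:R `^ (d%:R - 1)]
    & exists2 C : R, 0 < C & forall q, prime_power q ->
        forall m : 'rV[F q]_d, m != 0 ->
          Normc.normc (fourier_indicator (chi q) (V q) m)
            <= C * q%:R `^ (- ((d%:R + 1) / 2))].

(* Main.v *)
(* Write [S(m)] for the exponential sum of [E] at [m], [n = |E|] and
   [a = q^((d-1)/2)].  Expanding the condition [Q (x_1 + ... + x_k) = t] in
   characters and using that the quadric [Q = t] has Fourier coefficients
   [O(a / q^d)] away from [0], the count differs from [n^k / q] by
   [O((n^k + A_k) / (a q))], where [A_k] is the sum of [|S(m)|^k] over [m <> 0].

   Moments: since [E] lies in the regular set [V], completing one variable of [E]
   to [V] gives [A_(2j+2) << a^2 n^(2j+1) + a A_(2j+1)]; with AM-GM and Parseval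
   this yields [A_(2j) << a^2 n^(2j-1) + q a^(2j) n], and AM-GM again handles odd
   exponents.  These are [o(a n^k)] when [n / (a q^(1/(k-1)))] tends to
   infinity.

   Quadrics: completing the square reduces their Fourier coefficients to
   Kloosterman and Salie sums.  Salie sums are elementary.  For the Kloosterman sum
   [Kl] over a field with [q] elements, the sum over the quadratic extension is
   [2 q - Kl^2]; so if [|Kl| > 3 sqrt q], then [|Kl| / sqrt q] is unbounded along a
   tower of quadratic extensions, which is refuted by Stepanov's method applied to
   the equations [Tr (x + b / x) = tau]. *)

Require Import Defs.
From mathcomp Require Import all_boot all_order all_algebra.
From mathcomp Require Import fingroup cyclic finalg qfpoly finfield.
From mathcomp Require Import all_classical all_reals all_analysis.
From mathcomp Require Import complex.
From mathcomp Require Import zify ring lra.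
Import Order.TTheory GRing.Theory Num.Theory FinRing.Theory.
Import numFieldNormedType.Exports.
Set Implicit Arguments.
Unset Strict Implicit.
Unset Printing Implicit Defensive.
Local Open Scope ring_scope.

(** * Linear relations between polynomials, and Frobenius powers *)

(** The coefficient matrix has more rows than columns, hence a nonzero left kernel. This supplies
    the coefficients of the auxiliary polynomial in Stepanov's method. *)
Lemma exists_poly_relation (K : fieldType) (I : finType) (p : I -> {poly K})
    (M : nat) : (forall i, size (p i) <= M)%N -> (M < #|I|)%N ->
  exists2 c : I -> K, exists i, c i != 0 & \sum_i c i *: p i = 0.
Proof.
move=> sp MI.
pose W : 'M[K]_(#|I|, M) := \matrix_(i, m) (p (enum_val i))`_m.
have : kermx W != 0.
  rewrite kermx_eq0 -row_leq_rank -ltnNge.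
  exact: leq_ltn_trans (rank_leq_col _) MI.
case/matrix0Pn=> i0 [j0 nz].
exists (fun i => kermx W i0 (enum_rank i)).
  by exists (enum_val j0); rewrite enum_valK.
apply/polyP=> m; rewrite coef0 coef_sum.
have [mM|mM] := ltnP m M; last first.
  rewrite big1 // => i _; rewrite coefZ nth_default ?mulr0 //.
  exact: leq_trans (sp i) mM.
have e : (kermx W *m W) i0 (Ordinal mM) = 0 by rewrite mulmx_ker mxE.
rewrite -[RHS]e mxE (reindex (@enum_rank I)) /=; last first.
  by apply: onW_bij; exact: enum_rank_bij.
by apply: eq_bigr => i _; rewrite coefZ [W _ _]mxE enum_rankK.
Qed.

(** The term of largest degree among those with nonzero coefficient cannot cancel. This keeps the
    auxiliary polynomial from vanishing. *)
Lemma distinct_sizes_free (K : idomainType) (I : finType) (p : I -> {poly K})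
    (D : I -> nat) (c : I -> K) : (forall i, size (p i) = (D i).+1) ->
  injective D -> (exists i, c i != 0) -> \sum_i c i *: p i != 0.
Proof.
move=> sp injD [i1 ci1].
case: (@arg_maxnP _ i1 (fun i => c i != 0) D ci1) => i0 ci0 max0.
apply/eqP => /(congr1 (fun f : {poly K} => f`_(D i0))).
rewrite coef0 coef_sum (bigD1 i0) //= big1 ?addr0 => [|i ii0].
  rewrite coefZ; apply/eqP; rewrite mulf_neq0 //.
  have := sp i0; rewrite -[in _`_(D i0)]/((D i0).+1.-1) => sz; rewrite -sz.
  by rewrite -lead_coefE lead_coef_eq0 -size_poly_eq0 sz.
rewrite coefZ; have [->|ci] := eqVneq (c i) 0; first by rewrite mul0r.
rewrite nth_default ?mulr0 // sp ltn_neqAle (max0 _ ci : (D i <= D i0)%N) andbT.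
by apply: contra ii0 => /eqP /injD ->.
Qed.

(** Every prime divisor of [q] divides [#|K|], hence is the characteristic. Raising to a power of
    [q] is therefore additive on [K]. *)
Lemma finField_pnat (K : finFieldType) (q n : nat) :
  (0 < n)%N -> #|K| = (q ^ n)%N -> [pchar K].-nat q.
Proof.
move=> n0 cK; have [p pp pK] := finPcharP K.
rewrite (eq_pnat _ (pcharf_eq pK)).
have: p.-nat #|K|.
  rewrite -(eq_pnat _ (pcharf_eq pK)) (card_pprimeChar pK) pnatX.
  by rewrite pnatE // pK.
by rewrite cK pnatX (negPf (lt0n_neq0 n0)) orbF.
Qed.

Lemma expr_sum_pnat (K : comNzRingType) (I : Type) (s : seq I) (P : pred I)
    (G : I -> K) (n : nat) : [pchar K].-nat n ->
  (\sum_(i <- s | P i) G i) ^+ n = \sum_(i <- s | P i) G i ^+ n.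
Proof.
move=> nn; have n0 : (0 < n)%N by case/andP: nn.
apply: (big_morph (fun x => x ^+ n)) => [x y|]; first exact: exprDn_pchar.
by rewrite expr0n (negPf (lt0n_neq0 n0)).
Qed.

Lemma base_expansion_inj (m a b x y : nat) : (a < m)%N -> (b < m)%N ->
  (a + m * x = b + m * y)%N -> a = b /\ x = y.
Proof.
move=> am bm; rewrite ![(m * _)%N]mulnC ![(_ + _ * m)%N]addnC => e.
have m0 : (0 < m)%N by apply: leq_ltn_trans am.
split; first by move/(congr1 (modn^~ m)): e; rewrite !modnMDl !modn_small.
by move/(congr1 (divn^~ m)): e; rewrite !divnMDl // !divn_small // !addn0.
Qed.

(** * Stepanov's method *)

Section Stepanov.
Variables (K : finFieldType) (q l : nat) (b tau : K).
Hypothesis l_gt0 : (0 < l)%N.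
Hypothesis cardK : #|K| = (q ^ (2 * l))%N.

Let rho := (q ^ l.-1)%N.
Let r := (q ^ l)%N.
(** With this range for [j] there are [q rho^2 + 2 q rho] indices, more than the bound of [size_Pe]
    on the number of coefficients of the [Pe w]. *)
Let J := (rho + 2)%N.

Let qpn : [pchar K].-nat q.
Proof. by apply: (finField_pnat _ cardK); rewrite muln_gt0. Qed.

Let q_gt1 : (1 < q)%N.
Proof.
have := finNzRing_gt1 K; rewrite cardK; case: (q) => [|[|]] //.
  by rewrite exp0n ?muln_gt0.
by rewrite exp1n.
Qed.

Let rho_gt0 : (0 < rho)%N. Proof. by rewrite expn_gt0 ltnW. Qed.
Let rE : r = (q * rho)%N. Proof. by rewrite /r /rho -expnS prednK. Qed.

Let idx := ('I_rho * ('I_J * 'I_q))%type.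

(** The first half of the conjugates of [x + b / x]; adding the [r]-th power supplies the other half
    ([half_trace_r]). *)
Definition half_trace (x : K) : K := \sum_(i < l) (x + b / x) ^+ (q ^ i).

(* [Tt] is [X^rho] times the half trace [T], which is only a Laurent polynomial. *)
Let Tt : {poly K} :=
  \sum_(i < l) ('X^(rho + q ^ i) + (b ^+ (q ^ i)) *: 'X^(rho - q ^ i)).

(* The auxiliary polynomial is a combination of the [Pw w], i.e. of the
   [X^(i + j r) T^u] cleared of denominators.  At a solution [x] of
   [T + T^r = tau] one has [T^r = tau - T] and [x^(r^2) = x], so that the [r]-th
   power of [Pw w] agrees there with [Pe w] up to a power of [x] not depending on
   [w], while the degree of [Pe w] is about [r] times smaller. *)
Let Pw (w : idx) : {poly K} :=
  'X^(w.1 + w.2.1 * r + (q.-1 - w.2.2) * rho) * Tt ^+ w.2.2.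

Let Pe (w : idx) : {poly K} :=
  'X^(w.1 * r + w.2.1 + (q.-1 - w.2.2) * rho) * (tau *: 'X^rho - Tt) ^+ w.2.2.

Let pow_le i : (i < l)%N -> (q ^ i <= rho)%N.
Proof. by move=> il; rewrite leq_exp2l // -ltnS prednK. Qed.

(** Only the summand [i = l - 1], where [q ^ i = rho], reaches degree [2 rho]. *)
Let size_Tt : size Tt = (2 * rho).+1.
Proof.
have -> : Tt = \sum_(i < l.-1.+1)
    ('X^(rho + q ^ i) + (b ^+ (q ^ i)) *: 'X^(rho - q ^ i)) by rewrite prednK.
rewrite big_ord_recr /= -/rho subnn expr0 addrCA addrC.
have szX : size ('X^(rho + rho) : {poly K}) = (2 * rho).+1.
  by rewrite size_polyXn addnn mul2n.
rewrite addrC size_polyDl szX // ltnS.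
apply: (leq_trans (size_polyD _ _)); rewrite geq_max; apply/andP; split; last first.
  by apply: (leq_trans (size_scale_leq _ _)); rewrite size_polyC oner_eq0 /=; lia.
apply: (leq_trans (size_sum _ _ _)); apply/bigmax_leqP => i _.
have lti : (q ^ i < rho)%N by rewrite ltn_exp2l.
apply: (leq_trans (size_polyD _ _)); rewrite geq_max size_polyXn.
apply/andP; split; first by lia.
by apply: (leq_trans (size_scale_leq _ _)); rewrite size_polyXn; lia.
Qed.

Let Tt_eval x : x != 0 -> Tt.[x] = x ^+ rho * half_trace x.
Proof.
move=> x0; rewrite /Tt horner_sum /half_trace mulr_sumr.
apply: eq_bigr => i _; rewrite !hornerE.
rewrite exprDn_pchar; last by rewrite pnatX qpn.
rewrite mulrDr -exprD expr_div_n; congr (_ + _).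
rewrite expfB_cond; last by rewrite (negPf x0) add0n pow_le.
by field; rewrite expf_neq0.
Qed.

Let half_trace_r x :
  half_trace x + half_trace x ^+ r = \sum_(i < 2 * l) (x + b / x) ^+ (q ^ i).
Proof.
rewrite mul2n -addnn big_split_ord /=; congr (_ + _).
rewrite /half_trace expr_sum_pnat; last by rewrite pnatX qpn.
by apply: eq_bigr => i _; rewrite -exprM -expnD addnC.
Qed.

(** The [(q - 1 - u) rho] from clearing denominators and the [2 rho u] from [Tt ^+ u] add up to
    [(q - 1) rho + rho u]. The degree thus has [i], [u], [j] as digits in a mixed base, which gives
    [D_inj]. *)
Let size_Pw w : size (Pw w) = (w.1 + rho * (w.2.2 + q * w.2.1) + q.-1 * rho).+1.
Proof.
have Tn0 : Tt != 0 by rewrite -size_poly_eq0 size_Tt.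
rewrite /Pw size_monicM ?monicXn ?expf_neq0 //.
have := size_exp Tt w.2.2; rewrite size_Tt /=.
have : (0 < size (Tt ^+ w.2.2))%N by rewrite size_poly_gt0 expf_neq0.
move=> s0 s1; rewrite size_polyXn.
have -> : size (Tt ^+ w.2.2) = (2 * rho * w.2.2).+1 by rewrite -s1 prednK.
rewrite rE; have := ltn_ord w.2.2; set i := nat_of_ord w.2.2 => iq.
have : q.-1 = ((q.-1 - i) + i)%N by lia.
move=> ->; rewrite addnK; move: (_ - i)%N => u /=; lia.
Qed.

Let D (w : idx) : nat := (w.1 + rho * (w.2.2 + q * w.2.1) + q.-1 * rho)%N.

Let D_inj : injective D.
Proof.
move=> [i [j u]] [i' [j' u']]; rewrite /D /= => /addIn.
case/(base_expansion_inj (ltn_ord _) (ltn_ord _)) => /val_inj ->.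
by case/(base_expansion_inj (ltn_ord _) (ltn_ord _)) => /val_inj -> /val_inj ->.
Qed.

Let size_Pe w : (size (Pe w) <= q * rho ^ 2 + q * rho - rho + 2)%N.
Proof.
rewrite /Pe; apply: (leq_trans (size_polyMleq _ _)).
rewrite size_polyXn /=.
have s1 : (size (tau *: 'X^rho - Tt)%R <= (2 * rho).+1)%N.
  apply: (leq_trans (size_polyD _ _)); rewrite size_polyN size_Tt geq_max leqnn andbT.
  by apply: (leq_trans (size_scale_leq _ _)); rewrite size_polyXn; lia.
have s2 : (size ((tau *: 'X^rho - Tt) ^+ w.2.2)%R <= (2 * rho * w.2.2).+1)%N.
  apply: (leq_trans (size_poly_exp_leq _ _)); rewrite ltnS leq_mul2r; apply/orP; right; lia.
apply: (leq_trans (leq_add (leqnn _) s2)).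
rewrite rE; case: w {s1 s2} => [i [j u]] /=.
have := ltn_ord u; have := ltn_ord j; have := ltn_ord i.
move: (i : nat) (j : nat) (u : nat) => {}i {}j {}u; rewrite /J => ir jr uq.
have h1 : (i * (q * rho) <= rho.-1 * (q * rho))%N by rewrite leq_mul2r; apply/orP; right; lia.
have h2 : (u * rho <= q.-1 * rho)%N by rewrite leq_mul2r; apply/orP; right; lia.
have h3 : ((q.-1 - u) * rho + u * rho = q.-1 * rho)%N by rewrite -mulnDl subnK //; lia.
have h4 : (rho.-1 * (q * rho) + q * rho = q * rho ^ 2)%N by rewrite -mulSnr prednK // mulnC -mulnA.
have h5 : (q.-1 * rho + rho = q * rho)%N by rewrite -mulSnr prednK // ltnW.
have h6 : (rho <= q * rho)%N by rewrite leq_pmull // ltnW.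
lia.
Qed.

(** A linear relation among the [Pe w] makes the polynomial [Psi], built from the [Pw w], vanish at
    every solution, and [Psi] is nonzero because the [Pw w] have distinct degrees; so its degree
    bounds the number of solutions. The main term is [#|K| / q], the error is of the order of the
    square root of [#|K|]. *)
Lemma stepanov :
  (#|[pred x : K | ((x != 0) &&
     (\sum_(i < 2 * l) (x + b / x) ^+ (q ^ i) == tau))%R]|
   <= q ^ (2 * l).-1 + 3 * q ^ l)%N.
Proof.
have r_gt0 : (0 < r)%N by rewrite expn_gt0 ltnW.
have cardr : #|K| = (r * r)%N by rewrite cardK mul2n -addnn expnD.
have [c c_nz c_rel] : exists2 c : idx -> K,
    exists i, c i != 0 & \sum_i c i *: Pe i = 0.
  apply: exists_poly_relation size_Pe _.
  rewrite !card_prod !card_ord /J.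
  have h6 : (2 * rho <= q * rho)%N by rewrite leq_mul2r q_gt1 orbT.
  have -> : (rho * ((rho + 2) * q) = q * rho ^ 2 + 2 * (q * rho))%N by ring.
  lia.
(* The exponent [r] on [c w] is undone by the [r]-th power taken below, since
   [c ^+ (r * r) = c ^+ #|K| = c]. *)
pose Psi := \sum_w (c w ^+ r) *: Pw w.
have Psi0 : Psi != 0.
  apply: distinct_sizes_free size_Pw D_inj _.
  by case: c_nz => i ci; exists i; rewrite expf_neq0.
have szPsi : (size Psi <= q * rho ^ 2 + 3 * (q * rho))%N.
  apply: (leq_trans (size_sum _ _ _)); apply/bigmax_leqP => w _.
  apply: (leq_trans (size_scale_leq _ _)); rewrite size_Pw.
  case: w => [i [j u]] /=.
  have := ltn_ord u; have := ltn_ord j; have := ltn_ord i.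
  move: (i : nat) (j : nat) (u : nat) => {}i {}j {}u; rewrite /J => ir jr uq.
  have h1 : (rho * (q * j) <= rho * (q * (rho + 1)))%N.
    by rewrite !leq_mul2l; apply/orP; right; apply/orP; right; lia.
  have h2 : (rho * u <= rho * q.-1)%N by rewrite leq_mul2l; apply/orP; right; lia.
  have h5 : (rho * q.-1 + rho = q * rho)%N by rewrite -mulnSr prednK 1?mulnC // ltnW.
  have h4 : (rho * (q * (rho + 1)) = q * rho ^ 2 + q * rho)%N by ring.
  rewrite mulnDr [(q.-1 * _)%N]mulnC; lia.
set A := [pred x | _].
have rootA x : x \in A -> root Psi x.
  rewrite inE => /andP[x0 /eqP trx].
  have rpn : [pchar K].-nat r by rewrite pnatX qpn.
  have: Psi.[x] ^+ r == 0; last by rewrite expf_eq0 r_gt0.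
  rewrite /Psi horner_sum expr_sum_pnat //.
  have Tr : half_trace x ^+ r = tau - half_trace x.
    by rewrite -trx -half_trace_r addrC addKr.
  (* Both sides carry the exponents [q.-1 - u] and [u] of [x ^+ rho], whose sum is [q.-1] for every
     [w]; hence correcting powers of [x] that do not depend on [w]. *)
  have key w : (c w ^+ r *: Pw w).[x] ^+ r * x ^+ (q.-1 * rho) =
      (c w *: Pe w).[x] * x ^+ (q.-1 * rho * r).
    rewrite /Pw /Pe !hornerE Tt_eval //.
    have -> : tau * x ^+ rho - x ^+ rho * half_trace x = x ^+ rho * half_trace x ^+ r.
      by rewrite Tr; ring.
    rewrite !exprMn -!exprM -cardr expf_card.
    have uq : (q.-1 = (q.-1 - w.2.2) + w.2.2)%N by have := ltn_ord w.2.2; lia.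
    rewrite [in RHS]uq [X in _ * x ^+ (X * rho) = _]uq.
    move: (q.-1 - _)%N => u; move: (nat_of_ord w.2.2) => i.
    have -> : x ^+ ((w.1 + w.2.1 * r + u * rho) * r) =
        x ^+ (w.1 * r) * x ^+ w.2.1 * x ^+ (u * rho * r).
      have e : (w.2.1 * r * r = #|K| * w.2.1)%N by rewrite cardr; ring.
      by rewrite !mulnDl !exprD e [x ^+ (#|K| * _)]exprM expf_card.
    have -> : (rho * (i * r) = i * rho * r)%N by ring.
    rewrite addnK [(r * i)%N]mulnC [(rho * i)%N]mulnC !mulnDl !exprD /=.
    by ring.
  have /(congr1 (fun p : {poly K} => p.[x])) := c_rel.
  rewrite horner0 horner_sum => e.
  have : (\sum_i (c i ^+ r *: Pw i).[x] ^+ r) * x ^+ (q.-1 * rho) = 0.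
    by rewrite mulr_suml (eq_bigr _ (fun w _ => key w)) -mulr_suml e mul0r.
  by move/eqP; rewrite mulf_eq0 expf_eq0 (negPf x0) andbF orbF.
have : (#|A| < size Psi)%N.
  rewrite cardE; apply: max_poly_roots => //; last exact: enum_uniq.
  by apply/allP => x; rewrite mem_enum => /rootA.
move=> h1; have := leq_trans h1 szPsi.
have -> : (q ^ (2 * l).-1 = q * rho ^ 2)%N.
  by rewrite /rho -expnM -expnS; congr (_ ^ _)%N; lia.
rewrite -[(q ^ l)%N]/r rE; lia.
Qed.
End Stepanov.

(** * Additive characters and Kloosterman sums *)

Section Characters.
Variable C : numClosedFieldType.

Definition additive_character (V : finZmodType) (chi : V -> C) : Prop :=
  chi 0 = 1 /\ {morph chi : x y / x + y >-> x * y}.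

Section Basic.
Variables (V : finZmodType) (chi : V -> C).
Hypothesis chiP : additive_character chi.

(** The order of the group kills [x], so [chi x] is a root of unity. *)
Lemma character_norm x : `|chi x| = 1.
Proof.
case: chiP => chi0 chiD.
have chiMn n : chi (x *+ n) = chi x ^+ n.
  by elim: n => [|n IH]; rewrite ?mulr0n ?expr0 // mulrS chiD IH exprS.
have xV : x *+ #|V| = 0.
  have /eqP := expg_cardG (finset.in_setT x).
  by rewrite zmodXgE cardsT => /eqP.
have V0 : (0 < #|V|)%N by apply/card_gt0P; exists 0.
by apply/eqP; rewrite -(pexpr_eq1 V0) // -normrX -chiMn xV chi0 normr1.
Qed.

Lemma character_neq0 x : chi x != 0.
Proof. by rewrite -normr_eq0 character_norm oner_eq0. Qed.

Lemma characterN x : chi (- x) = (chi x)^*.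
Proof.
case: chiP => chi0 chiD.
apply: (mulfI (character_neq0 x)); rewrite -chiD subrr chi0.
by rewrite -normCK character_norm expr1n.
Qed.

Lemma sum_character : (exists x, chi x != 1) -> \sum_x chi x = 0.
Proof.
case: chiP => chi0 chiD [a a1]; apply/eqP.
have : chi a * \sum_x chi x == \sum_x chi x.
  rewrite mulr_sumr [X in _ == X](reindex_inj (addrI a)) /=.
  by apply/eqP/eq_bigr => x _; rewrite chiD.
by rewrite -[X in _ == X]mul1r -subr_eq0 -mulrBl mulf_eq0 subr_eq0 (negPf a1).
Qed.

End Basic.

Definition kloosterman (K : finFieldType) (chi : K -> C) (b : K) : C :=
  \sum_(x | x != 0) chi (x + b / x).

(** Conjugation amounts to [x -> - x] in the sum. Realness lets [|Kl|^2] be replaced by [Kl^2] in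
    the tower argument. *)
Lemma kloosterman_real (K : finFieldType) (chi : K -> C) (b : K) :
  additive_character chi -> kloosterman chi b \is Num.real.
Proof.
move=> chiP; rewrite CrealE; apply/eqP.
rewrite /kloosterman rmorph_sum /= (reindex_inj oppr_inj) /=.
apply: eq_big => x; first by rewrite oppr_eq0.
by move=> _; rewrite invrN mulrN -opprD -characterN // opprK.
Qed.

(** Stepanov's method bounds the counts [M z] only from above, by [B]. As [chi] has sum zero, [M z]
    may be replaced by [M z - B], which has constant sign, and the sum of the absolute values
    follows from the total number of points. The factor [4 q] does not depend on [l]. *)
Lemma kloosterman_stepanov (K : finFieldType) (chi : K -> C) (b : K) (q l : nat) :
  (0 < l)%N -> #|K| = (q ^ (2 * l))%N ->
  additive_character chi -> (exists x, chi x != 1) ->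
  (forall z, \sum_(i < 2 * l) z ^+ (q ^ i) = 0 -> chi z = 1) ->
  `|kloosterman chi b| <= 4%:R * q%:R * q%:R ^+ l.
Proof.
move=> l0 cK chiP chi1 chitr; have [chi0 chiD] := chiP.
pose Tr (z : K) : K := \sum_(i < 2 * l) z ^+ (q ^ i).
have qpn : [pchar K].-nat q by apply: (finField_pnat _ cK); rewrite muln_gt0.
have q_gt0 : (0 < q)%N by case/andP: qpn.
have TrD : {morph Tr : x y / x + y}.
  move=> x y; rewrite /Tr -big_split /=; apply: eq_bigr => i _.
  by rewrite exprDn_pchar // pnatX qpn.
have TrN x : Tr (- x) = - Tr x.
  apply/eqP; rewrite -addr_eq0 -TrD addNr; apply/eqP.
  by rewrite /Tr big1 // => i _; rewrite expr0n gtn_eqF // expn_gt0 q_gt0.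
have Trq x : Tr x ^+ q = Tr x.
  rewrite /Tr expr_sum_pnat //.
  have -> : \sum_(i < 2 * l) (x ^+ (q ^ i)) ^+ q = \sum_(i < 2 * l) x ^+ (q ^ i.+1).
    by apply: eq_bigr => i _; rewrite -exprM expnSr.
  case: (2 * l)%N cK => [|n] cK; first by rewrite !big_ord0.
  by rewrite big_ord_recr [RHS]big_ord_recl /= -cK expf_card expn0 expr1 addrC.
pose kap := #|[pred z | Tr z == 0]|.
(* Letting [z] run over [K] rather than over the values of the trace counts every [x] exactly [kap]
   times. *)
pose M z := #|[pred x : K | ((x != 0) && (Tr (x + b / x) == Tr z))%R]|.
pose B := (q ^ (2 * l).-1 + 3 * q ^ l)%N.
have MB z : (M z <= B)%N by exact: stepanov.
have fib w : #|[pred z | Tr z == Tr w]| = kap.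
  rewrite -[kap](card_imset _ (addrI w)); apply: eq_card => z.
  rewrite !inE; apply/eqP/imsetP => [e|[u]]; last first.
    by rewrite inE => /eqP u0 ->; rewrite TrD u0 addr0.
  by exists (z - w); rewrite ?subrKC // inE TrD TrN e subrr.
(* The values of the trace are roots of [X^q - X], so there are at most [q] of them, and each
   nonempty fibre has [kap] elements. *)
have kapq : (#|K| <= kap * q)%N.
  rewrite -sum1_card (partition_big Tr (mem [pred t : K | t ^+ q == t])) /=; last first.
    by move=> z _; rewrite inE Trq.
  have : (\sum_(j : K | j ^+ q == j) \sum_(i : K | Tr i == j) 1 <=
          \sum_(j : K | j ^+ q == j) kap)%N.
    apply: leq_sum => j _; rewrite sum1_card.
    case: (pickP [pred i | Tr i == j]) => [w /eqP <-|no]; first by rewrite fib.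
    by rewrite eq_card0.
  move/leq_trans; apply; rewrite sum_nat_const mulnC leq_mul2l; apply/orP; right.
  have q_gt1 : (1 < q)%N.
    have := finNzRing_gt1 K; rewrite cK; case: (q) q_gt0 => [|[|]] //.
    by rewrite exp1n.
  have sz : size ('X^q - 'X : {poly K}) = q.+1.
    by rewrite size_polyDl size_polyXn // size_polyN size_polyX ltnS.
  rewrite -ltnS -sz cardE; apply: max_poly_roots; last exact: enum_uniq.
    by rewrite -size_poly_eq0 sz.
  apply/allP => t; rewrite mem_enum => tq; rewrite /root !hornerE subr_eq0; exact: tq.
have kap_gt0 : 0 < kap%:R :> C.
  by rewrite ltr0n /kap; apply/card_gt0P; exists 0; rewrite inE -[X in Tr X](subrr 0) TrD TrN subrr.
have sumM : \sum_z chi z * (M z)%:R = kap%:R * kloosterman chi b.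
  have e1 z : chi z * (M z)%:R = \sum_(x | (x != 0) && (Tr (x + b / x) == Tr z)) chi z.
    by rewrite sumr_const mulr_natr.
  rewrite (eq_bigr _ (fun z _ => e1 z)).
  rewrite (exchange_big_dep (fun x : K => x != 0)) /=; last by move=> ? ? _ /andP[].
  rewrite mulr_sumr; apply: eq_bigr => x x0; rewrite x0 /=.
  rewrite mulr_natl -(fib (x + b / x)) -sumr_const; apply: eq_big => z.
    by rewrite inE eq_sym.
  move/eqP => e; rewrite -[z](subrK (x + b / x)) chiD.
  by rewrite [chi (z - _)]chitr ?mul1r // -/(Tr _) TrD TrN e subrr.
have sumM1 : \sum_z (M z)%:R = kap%:R * (#|K|%:R - 1) :> C.
  have e1 z : (M z)%:R = \sum_(x | (x != 0) && (Tr (x + b / x) == Tr z)) 1 :> C.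
    by rewrite sumr_const.
  rewrite (eq_bigr _ (fun z _ => e1 z)).
  rewrite (exchange_big_dep (fun x : K => x != 0)) /=; last by move=> ? ? _ /andP[].
  have -> : #|K|%:R - 1 = \sum_(x : K | x != 0) 1 :> C.
    have : #|K|%:R = \sum_(x : K) 1 :> C by rewrite sumr_const.
    by rewrite (bigD1 0) //= => ->; rewrite addrAC subrr add0r.
  rewrite mulr_sumr; apply: eq_bigr => x x0; rewrite x0 /=.
  rewrite mulr1 -(fib (x + b / x)) -sumr_const; apply: eq_bigl => z.
  by rewrite inE eq_sym.
have bound : kap%:R * `|kloosterman chi b| <=
    B%:R * #|K|%:R - kap%:R * (#|K|%:R - 1) :> C.
  rewrite -[kap%:R in X in X <= _]ger0_norm ?ler0n // -normrM -sumM -sumM1.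
  have -> : \sum_z chi z * (M z)%:R = \sum_z chi z * ((M z)%:R - B%:R).
    under [RHS]eq_bigr => z _ do rewrite mulrBr.
    by rewrite sumrB -mulr_suml (sum_character chiP chi1) mul0r subr0.
  apply: (le_trans (ler_norm_sum _ _ _)).
  have -> : B%:R * #|K|%:R = \sum_(z : K) B%:R :> C by rewrite sumr_const mulr_natr.
  rewrite -sumrB; apply: ler_sum => z _.
  by rewrite normrM character_norm // mul1r distrC ger0_norm // subr_ge0 ler_nat.
rewrite -(ler_pM2l kap_gt0); apply: (le_trans bound).
have h1 : B%:R * #|K|%:R <= B%:R * (kap%:R * q%:R) :> C.
  by rewrite ler_wpM2l // -natrM ler_nat.
apply: (le_trans (lerB h1 (lexx _))).
have -> : B%:R * (kap%:R * q%:R) - kap%:R * (#|K|%:R - 1) =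
  kap%:R * (B%:R * q%:R - (#|K|%:R - 1)) :> C by ring.
rewrite ler_wpM2l //.
have BE : (B * q = #|K| + 3 * q * q ^ l)%N.
  have -> : #|K| = (q ^ (2 * l).-1 * q)%N by rewrite cK -expnSr prednK // muln_gt0.
  by rewrite /B; ring.
rewrite -natrM BE natrD !natrM natrX.
have : 1 <= q%:R * q%:R ^+ l :> C by rewrite -natrX -natrM ler1n muln_gt0 expn_gt0 q_gt0.
move=> h2.
have -> : #|K|%:R + 3 * q%:R * q%:R ^+ l - (#|K|%:R - 1) =
  3 * (q%:R * q%:R ^+ l) + 1 :> C by ring.
have -> : 4 * q%:R * q%:R ^+ l = 3 * (q%:R * q%:R ^+ l) + q%:R * q%:R ^+ l :> C by ring.
by rewrite lerD2l.
Qed.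

End Characters.

(** * Quadratic extensions and the Kloosterman bound *)

(** If [(s, p)] is not the sum and product of two elements of [K], then [X^2 - s X + p] has no root,
    and the quotient by it is the extension; this covers every characteristic at once. *)
Lemma quadratic_extension (K : finFieldType) :
  exists (L : finFieldType) (f : {rmorphism K -> L}), #|L| = (#|K| ^ 2)%N.
Proof.
pose sp (w : K * K) := (w.1 + w.2, w.1 * w.2).
(* [(x, y) -> (x + y, x y)] is not injective, hence not surjective. *)
have [[s p] no_sp] : exists v : K * K, forall w, sp w != v.
  case: (pickP [pred v : K * K | [forall w, sp w != v]]) => [v /forallP|no].
    by exists v.
  have surj v : exists w, sp w = v.
    by have /= := no v; move/negbT; rewrite negb_forall => /existsP[w /negbNE/eqP <-]; exists w.
  have /image_injP inj : #|fintype.image sp predT| == #|{: K * K}|.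
    by apply/eqP/eq_card => v; have [w <-] := surj v; rewrite !inE fintype.image_f.
  have /inj : sp (0, 1) = sp (1, 0) by rewrite /sp /= addrC mulrC.
  by move=> /(_ isT isT)[/eqP]; rewrite eq_sym oner_eq0.
pose h : {poly K} := 'X^2 - s *: 'X + p%:P.
have sz1 : (size (- (s *: 'X) + p%:P : {poly K})%R <= 2)%N.
  apply: (leq_trans (size_polyD _ _)); rewrite size_polyN geq_max.
  rewrite (leq_trans (size_scale_leq _ _)) ?size_polyX //=.
  by rewrite size_polyC; case: (p != 0).
have szh : size h = 3 by rewrite /h -addrA size_polyDl size_polyXn.
have hm : h \is monic.
  by rewrite monicE lead_coefE szh /h !coefE /= mulr0 !subr0 addr0.
have hi : irreducible_poly h.
  apply: cubic_irreducible => [|x]; first by rewrite szh.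
  apply/negP => /rootP; rewrite /h !hornerE => e.
  have /eqP := no_sp (x, s - x); apply; rewrite /sp /= addrC subrK; congr (_, _).
  by apply/eqP; rewrite -subr_eq0 -oppr_eq0 -e; apply/eqP; ring.
have mi : monic_irreducible_poly h by [].
exists ({poly %/ h with mi} : finFieldType).
exists (GRing.in_alg {poly %/ h with mi}).
by rewrite card_qfpoly szh.
Qed.

(** [X^#|K| - X] already splits over [K], so its roots in [L] come from [K]. *)
Lemma fixed_by_card (K L : finFieldType) (f : {rmorphism K -> L}) (w : L) :
  w ^+ #|K| = w -> exists u, f u = w.
Proof.
move=> e; have /(congr1 (fun g : {poly L} => g.[w])) :=
  congr1 (map_poly f) (finField_genPoly K).
rewrite rmorphB /= map_polyXn map_polyX !hornerE e subrr => /esym/eqP.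
rewrite rmorph_prod horner_prod /= => /prodf_eq0[u _].
by rewrite map_polyXsubC !hornerE subr_eq0 => /eqP ->; exists u.
Qed.

Lemma sum_character_mul (C : numClosedFieldType) (K : finFieldType)
    (chi : K -> C) (c : K) : additive_character chi -> (exists x, chi x != 1) ->
  \sum_s chi (s * c) = if c == 0 then #|K|%:R else 0.
Proof.
move=> chiP chi1; have [->|c0] := eqVneq c 0.
  under eq_bigr => s _ do rewrite mulr0 chiP.1.
  by rewrite sumr_const.
rewrite -[RHS](sum_character chiP chi1) [RHS](reindex_inj (mulIf c0)).
exact: eq_bigr.
Qed.

Section Doubling.
Variables (C : numClosedFieldType) (K L : finFieldType) (f : {rmorphism K -> L}).
Hypothesis cardL : #|L| = (#|K| ^ 2)%N.
Let Q := #|K|.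

(** Inverse of [f] on its image, the set of fixed points of [w -> w ^+ Q]; relative traces and norms
    lie there, so the default [0] is harmless. *)
Let pullback (w : L) : K := odflt 0 [pick u | f u == w].

Let pullbackP w : w ^+ Q = w -> f (pullback w) = w.
Proof.
case/(fixed_by_card f) => u <-; rewrite /pullback; case: pickP => [v /eqP //|].
by move/(_ u); rewrite eqxx.
Qed.

Let Qpn : [pchar L].-nat Q.
Proof. exact: (finField_pnat (K := L) (n := 2) isT cardL). Qed.

Let powQQ (z : L) : (z ^+ Q) ^+ Q = z.
Proof. by rewrite -exprM -[RHS]expf_card cardL. Qed.

Definition rel_trace (z : L) : K := pullback (z + z ^+ #|K|).
Definition rel_norm (z : L) : K := pullback (z * z ^+ #|K|).

Let traceE z : f (rel_trace z) = z + z ^+ Q.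
Proof. by apply: pullbackP; rewrite exprDn_pchar // powQQ addrC. Qed.

Let normE z : f (rel_norm z) = z * z ^+ Q.
Proof. by apply: pullbackP; rewrite exprMn powQQ mulrC. Qed.

Let fQ u : f u ^+ Q = f u. Proof. by rewrite -rmorphXn expf_card. Qed.

Lemma rel_traceD : {morph rel_trace : x y / x + y}.
Proof.
move=> x y; apply: (fmorph_inj f); rewrite rmorphD /= !traceE.
by rewrite exprDn_pchar // addrACA.
Qed.

(** [X^Q + X] has at most [Q < Q^2] roots, so some trace is nonzero; [K]-linearity scales it to any
    value. *)
Lemma rel_trace_surj u : exists z, rel_trace z = u.
Proof.
have [z z0] : exists z, rel_trace z != 0.
  case: (pickP [pred z | rel_trace z != 0]) => [z|no]; first by exists z.
  have Q1 : (1 < Q)%N := finNzRing_gt1 K.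
  have sz : size ('X^Q + 'X : {poly L}) = Q.+1.
    by rewrite size_polyDl size_polyXn // size_polyX ltnS.
  have : (#|L| < size ('X^Q + 'X : {poly L})%R)%N.
    rewrite cardE; apply: max_poly_roots; last exact: enum_uniq.
      by rewrite -size_poly_eq0 sz.
    apply/allP => z _; rewrite /root !hornerE addrC -traceE.
    by have /negbFE/eqP -> := no z; rewrite rmorph0.
  by rewrite sz cardL ltnS; rewrite -mulnn leqNgt ltn_Pmull // ltnW.
exists (f (u / rel_trace z) * z); apply: (fmorph_inj f).
rewrite traceE exprMn fQ -mulrDr -traceE -rmorphM /=.
by rewrite divfK.
Qed.

Let rootsE (s p : K) (z : L) : rel_trace z = s -> rel_norm z = p ->
  z ^+ 2 - f s * z + f p = 0.
Proof. by move=> <- <-; rewrite traceE normE; ring. Qed.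

(** With [v = (s, p)], these are the two ways to factor [X^2 - s X + p]: by an ordered pair of roots
    in [K], or by an element of [L] and its conjugate. *)
Let split_pairs (v : K * K) :=
  [pred w : K * K | (w.1 + w.2 == v.1) && (w.1 * w.2 == v.2)].
Let field_elts (v : K * K) :=
  [pred z : L | (rel_trace z == v.1) && (rel_norm z == v.2)].

(** A pair is determined by its first entry, so both sets embed into the roots of [X^2 - s X + p] in
    [L]. The images can meet only in a double root coming from [K]; that case is treated first, and
    there each set has at most one element. *)
Let count_le2 v : (#|split_pairs v| + #|field_elts v| <= 2)%N.
Proof.
case: v => s p.
pose h : {poly L} := 'X^2 - (f s *: 'X - (f p)%:P).
have szh : size h = 3.
  rewrite /h size_polyDl size_polyXn // size_polyN ltnS.
  apply: (leq_trans (size_polyD _ _)); rewrite size_polyN geq_max.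
  rewrite (leq_trans (size_scale_leq _ _)) ?size_polyX //=.
  by rewrite size_polyC; case: (_ != 0).
have hE z : h.[z] = z ^+ 2 - f s * z + f p by rewrite /h !hornerE; ring.
have pairE w : w \in split_pairs (s, p) ->
    w.1 + w.2 = s /\ (f w.1) ^+ 2 - f s * f w.1 + f p = 0.
  rewrite inE /= => /andP[/eqP <- /eqP <-]; split => //.
  by rewrite rmorphD rmorphM /=; ring.
have eltE z : z \in field_elts (s, p) ->
    z + z ^+ Q = f s /\ z ^+ 2 - f s * z + f p = 0.
  rewrite inE /= => /andP[/eqP e1 /eqP e2]; split; last exact: rootsE.
  by rewrite -traceE e1.
case: (pickP [pred x : K | (x + x == s) && (x * x == p)]) => [x|no].
  rewrite /= => /andP[/eqP es /eqP ep].
  have sq z : z ^+ 2 - f s * z + f p = 0 -> z = f x.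
    rewrite -es -ep rmorphD rmorphM /= => e; apply/eqP.
    by rewrite -subr_eq0 -sqrf_eq0 -e; apply/eqP; ring.
  have le1 : (#|split_pairs (s, p)| <= 1)%N.
    apply/card_le1_eqP => w w' /pairE[e1 /sq/fmorph_inj e2] /pairE[e1' /sq/fmorph_inj e2'].
    move: e1 e1'; rewrite e2 e2' => <- /addrI.
    by case: w w' e2 e2' => [a1 a2] [b1 b2] /= -> -> ->.
  have le1' : (#|field_elts (s, p)| <= 1)%N.
    by apply/card_le1_eqP => z z' /eltE[_ /sq ->] /eltE[_ /sq ->].
  lia.
rewrite [#|split_pairs _|]cardE [#|field_elts _|]cardE.
rewrite -(size_map (fun w : K * K => f w.1)) -size_cat.
set rs := _ ++ _; suff : (size rs < size h)%N by rewrite szh.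
apply: max_poly_roots.
- by rewrite -size_poly_eq0 szh.
- apply/allP => z; rewrite mem_cat => /orP[/mapP[w]|]; rewrite mem_enum.
    by move=> /pairE[_ e] ->; rewrite /root hE e.
  by move=> /eltE[_ e]; rewrite /root hE e.
rewrite cat_uniq; apply/and3P; split; last exact: enum_uniq.
  rewrite map_inj_in_uniq ?enum_uniq // => w w'; rewrite !mem_enum.
  move=> /pairE[e1 _] /pairE[e1' _] /fmorph_inj e2.
  move: e1 e1'; rewrite e2 => <- /addrI.
  by case: w w' e2 => [a1 a2] [b1 b2] /= -> ->.
apply/hasPn => z; rewrite mem_enum => zE; apply/mapP => -[w].
rewrite mem_enum => wE ez.
have := no w.1 => /negbT/negP; apply.
have [es _] := pairE _ wE; have [] := eltE _ zE.
rewrite ez fQ -rmorphD => /fmorph_inj e _ /=.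
rewrite e eqxx /=; move: wE; rewrite inE /= => /andP[_ /eqP <-].
by move: e; rewrite -es => /addrI ->.
Qed.

(* Equality holds in [count_le2], because both sides have the same sum over [v]. *)
Let count_eq2 v : (#|split_pairs v| + #|field_elts v| = 2)%N.
Proof.
have tot : (\sum_v (#|split_pairs v| + #|field_elts v|) = \sum_(v : K * K) 2)%N.
  rewrite big_split /=.
  have -> : (\sum_v #|split_pairs v| = Q * Q)%N.
    rewrite -card_prod -sum1_card.
    rewrite [RHS](partition_big (fun w : K * K => (w.1 + w.2, w.1 * w.2)) predT) //=.
    apply: eq_bigr => u _; rewrite -sum1_card; apply: eq_bigl => w.
    by rewrite inE [u]surjective_pairing xpair_eqE.
  have -> : (\sum_v #|field_elts v| = Q * Q)%N.
    rewrite mulnn -cardL -sum1_card.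
    rewrite [RHS](partition_big (fun z => (rel_trace z, rel_norm z)) predT) //=.
    apply: eq_bigr => u _; rewrite -sum1_card; apply: eq_bigl => w.
    by rewrite inE [u]surjective_pairing xpair_eqE.
  by rewrite sum_nat_const card_prod muln2 addnn.
apply/eqP; have := @leqif_sum _ xpredT _ _ _
  (fun v _ => leqif_eq (count_le2 v)).
by case=> _; rewrite tot eqxx => /esym/forallP/(_ v).
Qed.

Variables (chi : K -> C) (b : K).
Hypothesis chiP : additive_character chi.
Hypothesis chi1 : exists x, chi x != 1.
Hypothesis b0 : b != 0.

(** The value of [chi] at [x + y + b / x + b / y] when [x + y = v.1] and [x y = v.2]; equally that
    of [chiL] at [z + f b / z] when [z] has trace [v.1] and norm [v.2]. *)
Let sumP (v : K * K) := chi (v.1 + b * v.1 / v.2).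

Let kl_sq : kloosterman chi b ^+ 2 =
  \sum_(v : K * K | v.2 != 0) #|split_pairs v|%:R * sumP v.
Proof.
rewrite expr2 /kloosterman mulr_suml.
under eq_bigr => x _ do rewrite mulr_sumr.
rewrite pair_big /=.
rewrite (partition_big (fun w : K * K => (w.1 + w.2, w.1 * w.2))
  (fun v : K * K => v.2 != 0)) /=; last by move=> w; rewrite mulf_eq0 negb_or.
apply: eq_bigr => v v0; rewrite mulr_natl -sumr_const; apply: eq_big => w.
  rewrite [v]surjective_pairing xpair_eqE inE /=.
  have [e|_] := eqVneq (w.1 * w.2) v.2; last by rewrite !andbF.
  by move: v0; rewrite -e mulf_eq0 negb_or => ->.
move=> /andP[/andP[w1 w2]]; rewrite [v]surjective_pairing xpair_eqE => /andP[/eqP e1 /eqP e2].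
rewrite /sumP -chiP.2 /= -e1 -e2; congr (chi _); field.
by rewrite w1 w2.
Qed.

Let chiL (z : L) := chi (rel_trace z).

Let chiLP : additive_character chiL.
Proof.
have [chi0 chiD] := chiP; split=> [|x y]; rewrite /chiL; last by rewrite rel_traceD chiD.
suff -> : rel_trace 0 = 0 by [].
by apply: (fmorph_inj f); rewrite traceE rmorph0 add0r expr0n gtn_eqF // ltnW // finNzRing_gt1.
Qed.

Let kl_L : kloosterman chiL (f b) =
  \sum_(v : K * K | v.2 != 0) #|field_elts v|%:R * sumP v.
Proof.
have nm0 z : (rel_norm z == 0) = (z == 0).
  by rewrite -(inj_eq (fmorph_inj f)) normE rmorph0 -exprS expf_eq0.
rewrite /kloosterman.
rewrite (partition_big (fun z => (rel_trace z, rel_norm z))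
  (fun v : K * K => v.2 != 0)) /=; last by move=> z; rewrite nm0.
apply: eq_bigr => v v0; rewrite mulr_natl -sumr_const; apply: eq_big => z.
  rewrite [v]surjective_pairing xpair_eqE inE /=.
  have [e|_] := eqVneq (rel_norm z) v.2; last by rewrite !andbF.
  by move: v0; rewrite -e nm0 => ->.
move=> /andP[z0]; rewrite [v]surjective_pairing xpair_eqE => /andP[/eqP e1 /eqP e2].
rewrite /sumP /chiL; congr (chi _); apply: (fmorph_inj f).
rewrite /= rmorphD fmorph_div rmorphM /= -e1 -e2 traceE normE traceE.
rewrite exprDn_pchar // exprMn exprVn fQ.
have zQ : z ^+ Q != 0 by rewrite expf_neq0.
by rewrite /Q in zQ *; field; rewrite z0 zQ.
Qed.

(** By [count_eq2], the sum over [L] plus [Kl^2] is twice the sum of [chi (s (1 + b / p))] over all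
    [s] and all [p != 0]. Summing over [s] first leaves only [p = - b], which contributes [#|K|]. *)
Lemma kloosterman_doubling :
  [/\ additive_character chiL, exists x, chiL x != 1 &
   kloosterman chiL (f b) = 2 * #|K|%:R - kloosterman chi b ^+ 2].
Proof.
split => //.
  by have [u u1] := chi1; have [z zu] := rel_trace_surj u; exists z; rewrite /chiL zu.
apply/eqP; rewrite eq_sym subr_eq addrC kl_sq kl_L -big_split /=; apply/eqP/esym.
transitivity (\sum_(v : K * K | v.2 != 0) 2 * sumP v).
  by apply: eq_bigr => v _; rewrite -mulrDl -natrD count_eq2.
rewrite -mulr_sumr; congr (_ * _).
rewrite -(pair_big xpredT (fun p => p != 0) (fun s p => sumP (s, p))) /= exchange_big /=.
have e p : p != 0 -> \sum_s sumP (s, p) = if p == - b then #|K|%:R else 0.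
  move=> p0; rewrite -[RHS]/(if p == - b then _ else _).
  have -> : (p == - b) = (1 + b / p == 0).
    rewrite -[p == _](inj_eq (addIr b)) addNr -[1](divff p0) -mulrDl.
    by rewrite mulf_eq0 invr_eq0 (negPf p0) orbF.
  rewrite -(sum_character_mul _ chiP chi1); apply: eq_bigr => s _.
  by rewrite /sumP /=; congr (chi _); rewrite mulrDr mulr1 mulrCA mulrA.
rewrite (eq_bigr _ e) (bigD1 (- b)) ?oppr_eq0 //= eqxx big1 ?addr0 // => p /andP[_].
by move/negPf ->.
Qed.

(** Transitivity of the trace. It carries the hypothesis on [chi] in [kloosterman_stepanov] up the
    tower. *)
Lemma rel_trace_tower (q n : nat) : #|K| = (q ^ n)%N ->
  (forall z : K, \sum_(i < n) z ^+ (q ^ i) = 0 -> chi z = 1) ->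
  forall z : L, \sum_(i < 2 * n) z ^+ (q ^ i) = 0 -> chiL z = 1.
Proof.
move=> cK chitr z e; apply: chitr; apply: (fmorph_inj f).
rewrite rmorph0 -e mul2n -addnn big_split_ord /= rmorph_sum -big_split /=.
apply: eq_bigr => i _; rewrite rmorphXn /= traceE.
have qpn : [pchar L].-nat q.
  apply: (finField_pnat (n := n * 2)); last by rewrite cardL cK expnM.
  rewrite muln_gt0 andbT lt0n; apply: contraTneq (finNzRing_gt1 K) => n0.
  by rewrite cK n0.
by rewrite exprDn_pchar ?pnatX ?qpn // /Q cK -exprM -expnD.
Qed.

End Doubling.

(* If [Kl^2 = (4 + e) q] then [(2 q - Kl^2)^2 >= (4 + 4 e) q^2], so a violation of
   the bound is amplified along the quadratic tower until it contradicts
   [kloosterman_stepanov], whose constant does not depend on the height. *)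
Lemma kloosterman_bound (C : numClosedFieldType) (K : finFieldType)
    (chi : K -> C) (b : K) : additive_character chi -> (exists x, chi x != 1) ->
  b != 0 -> `|kloosterman chi b| ^+ 2 <= 9 * #|K|%:R.
Proof.
move=> chiP chi1 b0; set q := #|K|.
have q0 : (0 < q)%N by apply: ltnW; exact: finNzRing_gt1.
have nr : (9 * q%:R : C) \is Num.real by rewrite ger0_real // mulr_ge0 ?ler0n.
have kr : kloosterman chi b ^+ 2 \is Num.real by rewrite rpredX ?kloosterman_real.
rewrite real_normK ?kloosterman_real // (real_leNgt kr nr).
apply/negP => big.
(* The case [j = 0] is the assumed violation, since [9 = 4 + 5 * 4 ^+ 0]. *)
have tower j : exists (L : finFieldType) (psi : L -> C) (c : L),
  [/\ additive_character psi, exists x, psi x != 1, c != 0,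
      #|L| = (q ^ (2 ^ j))%N /\
      (forall z, \sum_(i < 2 ^ j) z ^+ (q ^ i) = 0 -> psi z = 1) &
      (4 + 5 * 4 ^+ j) * #|L|%:R <= kloosterman psi c ^+ 2].
  elim: j => [|j [L [psi [c [psiP psi1 c0 [cL trL] bnd]]]]].
    exists K, chi, b; split => //.
      split; first by rewrite expn1.
      by move=> z; rewrite big_ord1 expr1 => ->; case: chiP.
    by rewrite expr0 mulr1; apply: le_trans (ltW big); rewrite ler_wpM2r // -natrD ler_nat.
  have [L' [f cL']] := quadratic_extension L.
  have [psiP' psi1' klE] := kloosterman_doubling f cL' psiP psi1 c0.
  exists L', (fun z => psi (rel_trace f z)), (f c); split => //.
  - by rewrite fmorph_eq0.
  - split; first by rewrite cL' cL -expnM -expnSr.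
    by rewrite expnS; apply: rel_trace_tower.
  rewrite klE cL' natrX; set N := #|L|%:R.
  rewrite exprS; set E := 5 * 4 ^+ j in bnd *.
  have E0 : 0 <= E by rewrite /E -natrX -natrM ler0n.
  have N0 : 0 <= N :> C by rewrite ler0n.
  have h : (2 + E) * N <= kloosterman psi c ^+ 2 - 2 * N.
    rewrite lerBrDr; apply: le_trans bnd.
    by have -> : (2 + E) * N + 2 * N = (4 + E) * N by ring.
  have -> : (2 * N - kloosterman psi c ^+ 2) ^+ 2 = (kloosterman psi c ^+ 2 - 2 * N) ^+ 2.
    by ring.
  have h' : ((2 + E) * N) ^+ 2 <= (kloosterman psi c ^+ 2 - 2 * N) ^+ 2.
    by rewrite lerXn2r ?nnegrE // ?(le_trans _ h) // mulr_ge0 // addr_ge0.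
  apply: le_trans h'; rewrite exprMn ler_wpM2r ?exprn_ge0 //.
  have -> : 5 * (4 * 4 ^+ j) = 4 * E by rewrite /E; ring.
  have -> : (2 + E) ^+ 2 = 4 + 4 * E + E ^+ 2 by ring.
  by rewrite lerDl exprn_ge0.
(* At height [q + 1] the two bounds together give [4 + 5 * 4 ^ (q + 1) <= (4 q) ^ 2] after division
   by [#|L|], which [q < 2 ^ q] refutes. *)
have [L [psi [c [psiP psi1 c0 [cL trL] bnd]]]] := tower q.+1.
have := kloosterman_stepanov (l := 2 ^ q) c _ _ psiP psi1.
move=> /(_ q); rewrite -expnS expn_gt0 => /(_ isT cL trL) up.
have : (4 + 5 * 4 ^+ q.+1) * #|L|%:R <= (4 * q%:R) ^+ 2 * #|L|%:R :> C.
  apply: (le_trans bnd); rewrite -real_normK ?kloosterman_real //.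
  have -> : (4 * q%:R) ^+ 2 * #|L|%:R = (4 * q%:R * q%:R ^+ (2 ^ q)) ^+ 2 :> C.
    by rewrite cL expnSr natrX exprM [RHS]exprMn.
  by rewrite lerXn2r ?nnegrE ?mulr_ge0 ?exprn_ge0.
have L0 : 0 < #|L|%:R :> C by rewrite ltr0n ltnW // finNzRing_gt1.
rewrite ler_pM2r // -!natrX -!natrM -!natrD -natrX ler_nat.
have : (q < 2 ^ q)%N by exact: ltn_expl.
rewrite expnS -[4%N]/(2 ^ 2)%N -expnM mulnC [(2 * q)%N]mulnC expnM.
move: (2 ^ q)%N => m mq; nia.
Qed.

(** * Sums weighted by a function of the square class *)

Definition is_square (K : finFieldType) (x : K) : bool := [exists y, y ^+ 2 == x].

Definition quadratic_character (C : numClosedFieldType) (K : finFieldType) (x : K) : C :=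
  if x == 0 then 0 else if is_square x then 1 else -1.

(** Squaring is injective in characteristic 2, hence onto. *)
Lemma square_char2 (K : finFieldType) (x : K) : 2 = 0 :> K -> is_square x.
Proof.
move=> K2; apply/existsP.
have inj : injective (fun y : K => y ^+ 2).
  move=> y z /= e; apply/eqP; rewrite -subr_eq0 -sqrf_eq0.
  have -> : (y - z) ^+ 2 = 2 * (z ^+ 2 - y * z) by rewrite sqrrB e; ring.
  by rewrite K2 mul0r.
by have /codomP[y ->] := injF_onto inj x; exists y.
Qed.

Section OddCharacteristic.
Variables (C : numClosedFieldType) (K : finFieldType).
Hypothesis K2 : 2 != 0 :> K.
Local Notation eta := (@quadratic_character C K).

Lemma quadratic_character0 : eta 0 = 0.
Proof. by rewrite /quadratic_character eqxx. Qed.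

Lemma quadratic_character_sq (c : K) : c != 0 -> eta (c ^+ 2) = 1.
Proof.
move=> c0; rewrite /quadratic_character sqrf_eq0 (negPf c0) ifT //.
by apply/existsP; exists c.
Qed.

Lemma quadratic_character_norm (x : K) : x != 0 -> `|eta x| = 1.
Proof.
move=> /negPf x0; rewrite /quadratic_character x0.
by case: ifP; rewrite ?normrN normr1.
Qed.

Lemma card_square_roots (u : K) : #|[pred y : K | y ^+ 2 == u]|%:R = 1 + eta u :> C.
Proof.
rewrite /quadratic_character; case: eqP => [->|/eqP u0].
  rewrite addr0 (eq_card (B := pred1 0)) ?card1 // => y.
  by rewrite !inE sqrf_eq0.
case: ifP => [/existsP[y /eqP yu]|/negbT/existsPn no].
  have yN : y != - y.
    rewrite -subr_eq0 opprK -mulr2n -mulr_natl mulf_neq0 //.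
    by apply: contraNneq u0 => y0; rewrite -yu y0 expr0n.
  rewrite (eq_card (B := pred2 y (- y))) ?card2 ?yN // => z.
  by rewrite !inE -yu eqf_sqr.
by rewrite eq_card0 ?subrr // => y; rewrite inE (negPf (no y)).
Qed.

Lemma sum_square_roots (G : K -> C) :
  \sum_y G (y ^+ 2) = \sum_u (1 + eta u) * G u.
Proof.
rewrite (partition_big (fun y : K => y ^+ 2) predT) //=; apply: eq_bigr => u _.
by rewrite -card_square_roots mulr_natl -sumr_const; apply: eq_bigr => y /eqP ->.
Qed.

Lemma sum_quadratic_character : \sum_u eta u = 0.
Proof.
have := sum_square_roots (fun=> 1); under [X in _ = X -> _]eq_bigr => u _ do rewrite mulr1.
by rewrite big_split /= => /eqP; rewrite -subr_eq0 opprD addrA subrr sub0r oppr_eq0 => /eqP.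
Qed.

(** Multiplication by [a] maps the nonzero squares into the nonsquares. As [eta] has sum zero, the
    two sets are equinumerous, so every nonsquare [b] is [a] times a square. *)
Lemma nonsquare_mul (a b : K) : ~~ is_square a -> ~~ is_square b -> is_square (a * b).
Proof.
move=> na nb.
have n0 (x : K) : ~~ is_square x -> x != 0.
  by apply: contraNneq => ->; apply/existsP; exists 0; rewrite expr0n.
pose S := [pred x : K | (x != 0) && is_square x].
pose N := [pred x : K | ~~ is_square x].
have SN : #|S| = #|N|.
  apply/eqP; rewrite -(eqr_nat C) -subr_eq0 -sum_quadratic_character.
  rewrite (bigD1 0) //= quadratic_character0 add0r (bigID (@is_square K)) /=.
  rewrite -!sumr_const -sumrN; apply/eqP; congr (_ + _); apply: eq_big => x //=.
  - by move=> /andP[/negPf x0 xs]; rewrite /quadratic_character x0 xs.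
  - by rewrite inE; apply/idP/andP => [xs|[]//]; rewrite n0.
  - by rewrite inE => xs; rewrite /quadratic_character (negPf (n0 _ xs)) (negPf xs).
have sub : fintype.image (fun x => a * x) S \subset N.
  apply/fintype.subsetP => y0 /fintype.imageP[x]; rewrite !inE => /andP[x0 /existsP[y /eqP yx]] ->.
  apply: contra na => /existsP[z /eqP e]; apply/existsP; exists (z / y).
  by rewrite expr_div_n yx e mulfK.
have /subset_cardP/(_ sub)/(_ b) : #|fintype.image (fun x => a * x) S| = #|N|.
  by rewrite fintype.card_image // => x y /(mulfI (n0 _ na)).
rewrite [RHS]inE nb => /fintype.imageP[x]; rewrite inE => /andP[_ /existsP[y /eqP <-]] ->.
by apply/existsP; exists (a * y); rewrite mulrA exprMn -expr2.
Qed.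

Lemma quadratic_characterM (a b : K) : eta (a * b) = eta a * eta b.
Proof.
rewrite /quadratic_character mulf_eq0.
have [->|a0] := eqVneq a 0; first by rewrite /= mul0r.
have [->|b0] := eqVneq b 0; first by rewrite /= ?orbT ?eqxx ?orbT mulr0.
rewrite /=; have [/existsP[y /eqP ya]|na] := boolP (is_square a).
  rewrite mul1r; congr (if _ then _ else _); rewrite -ya.
  have y0 : y != 0 by apply: contraNneq a0 => y0; rewrite -ya y0 expr0n.
  apply/existsP/existsP => -[z /eqP e]; last by exists (y * z); rewrite exprMn e.
  by exists (z / y); rewrite expr_div_n e mulrC mulKf // sqrf_eq0.
have [/existsP[y /eqP yb]|nb] := boolP (is_square b); last first.
  by rewrite nonsquare_mul // mulrNN mulr1.
rewrite mulr1 ifN //; apply: contra na => /existsP[z /eqP e]; apply/existsP; exists (z / y).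
by rewrite expr_div_n yb e mulfK.
Qed.

Lemma quadratic_characterV (s : K) : s != 0 -> eta s^-1 = eta s.
Proof.
move=> s0; have -> : s^-1 = s * (s^-1) ^+ 2 by field.
by rewrite quadratic_characterM quadratic_character_sq ?mulr1 // invr_eq0.
Qed.

Variables (chi : K -> C) (r : C).
Hypothesis chiP : additive_character chi.
Hypothesis chi1 : exists x, chi x != 1.
Hypothesis r_ge0 : 0 <= r.
Hypothesis r_sq : r ^+ 2 = #|K|%:R.

(** The sum equals that of [chi (y ^+ 2 * c)]. In its squared modulus, the phase for a fixed
    difference [u] is linear in [y] with slope [- 2 u c], so only [u = 0] survives. *)
Lemma gauss_sum_bound (c : K) : c != 0 -> `|\sum_w eta w * chi (w * c)| <= r.
Proof.
move=> c0.
have -> : \sum_w eta w * chi (w * c) = \sum_y chi (y ^+ 2 * c).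
  rewrite (sum_square_roots (fun u => chi (u * c))).
  under [RHS]eq_bigr => u _ do rewrite mulrDl mul1r.
  by rewrite big_split /= (sum_character_mul _ chiP chi1) (negPf c0) add0r.
rewrite -ler_sqr ?nnegrE // r_sq normCK rmorph_sum mulr_suml /=.
rewrite le_eqVlt; apply/orP; left; apply/eqP.
under eq_bigr => y _ do rewrite mulr_sumr (reindex_inj (addIr y)) /=.
rewrite exchange_big /= (bigD1 0) //= [X in _ + X]big1 ?addr0 => [|u u0].
  under eq_bigr => y _ do rewrite add0r -normCK character_norm // expr1n.
  by rewrite sumr_const.
have e y : chi (y ^+ 2 * c) * (chi ((u + y) ^+ 2 * c))^* =
    chi (- (u ^+ 2 * c)) * chi (y * (- (2 * u * c))).
  by rewrite -characterN // -!chiP.2; congr chi; ring.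
under eq_bigr => y _ do rewrite e.
rewrite -mulr_sumr (sum_character_mul _ chiP chi1) oppr_eq0.
by rewrite !mulf_eq0 (negPf K2) (negPf c0) (negPf u0) mulr0.
Qed.

(** For [s != -1], [eta s = eta (w + 2)] with [w = s + 1 / s], and [w] is attained
    [1 + eta (w ^+ 2 - 4)] times. Since [eta (w + 2) * eta (w ^+ 2 - 4)] is [eta (w - 2)] for
    [w != -2], two shifted Gauss sums remain; the exceptional terms at [s = -1] and [w = -2]
    cancel. *)
Lemma salie_diag_bound (c : K) : c != 0 ->
  `|\sum_(s | s != 0) eta s * chi (c * (s + s^-1))| <= 2 * r.
Proof.
move=> c0.
have four0 : 4 != 0 :> K.
  have -> : 4 = 2 * 2 :> K by ring.
  by rewrite mulf_neq0.
(* [2 s - w] is a square root of the discriminant of [s ^+ 2 - w s + 1]. *)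
have cnt (w : K) : #|[pred s : K | (s != 0) && (s + s^-1 == w)]|%:R = 1 + eta (w ^+ 2 - 4) :> C.
  rewrite -card_square_roots.
  have inj : injective (fun s : K => 2 * s - w).
    by move=> x y /addIr /(mulfI K2).
  rewrite -(fintype.card_image inj); congr _%:R; apply: eq_card => y.
  rewrite [RHS]inE; apply/fintype.imageP/eqP => [[s]|e].
    rewrite inE => /andP[s0 /eqP <-] ->; by field.
  exists ((y + w) / 2); last by field.
  have sE : ((y + w) / 2) ^+ 2 - w * ((y + w) / 2) + 1 = 0.
    have -> : ((y + w) / 2) ^+ 2 - w * ((y + w) / 2) + 1 = (y ^+ 2 - (w ^+ 2 - 4)) / 2 ^+ 2.
      by field; rewrite four0 K2.
    by rewrite e subrr mul0r.
  move: ((y + w) / 2) sE => s sE.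
  have s0 : s != 0.
    by apply: contra_eq_neq sE => ->; rewrite expr0n mulr0 subrr add0r oner_eq0.
  rewrite inE s0 /= -subr_eq0 -(inj_eq (mulfI s0)) mulr0 -sE; apply/eqP; field.
  by [].
have eta_sq (x : K) : x != 0 -> eta x * eta x = 1.
  by move=> x0; rewrite -quadratic_characterM -expr2 quadratic_character_sq.
have -> : \sum_(s | s != 0) eta s * chi (c * (s + s^-1)) =
    \sum_(s | s != 0) eta (s + s^-1 + 2) * chi (c * (s + s^-1)) + eta (- 1) * chi (c * (-2)).
  rewrite (bigD1 (-1)) ?oppr_eq0 ?oner_eq0 //= invrN1 [in RHS](bigD1 (-1)) ?oppr_eq0 ?oner_eq0 //=.
  rewrite invrN1 -opprD addNr quadratic_character0 mul0r add0r addrC; congr (_ + _).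
  apply: eq_bigr => s /andP[s0 s1]; congr (_ * _).
  (* The point of the proof: [eta s] is a function of [s + 1 / s]. *)
  have -> : s + s^-1 + 2 = (s + 1) ^+ 2 * s^-1 by field.
  rewrite quadratic_characterM quadratic_character_sq ?mul1r ?quadratic_characterV //.
  by rewrite addr_eq0.
have -> : \sum_(s | s != 0) eta (s + s^-1 + 2) * chi (c * (s + s^-1)) =
    \sum_w eta (w + 2) * chi (c * w) * (1 + eta (w ^+ 2 - 4)).
  rewrite (partition_big (fun s => s + s^-1) predT) //=; apply: eq_bigr => w _.
  by rewrite -cnt mulr_natr -sumr_const; apply: eq_bigr => s /andP[_ /eqP ->].
have -> : \sum_w eta (w + 2) * chi (c * w) * (1 + eta (w ^+ 2 - 4)) =
    \sum_w eta (w + 2) * chi (c * w) + \sum_w eta (w - 2) * chi (c * w) -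
    eta (- 1) * chi (c * (-2)).
  under eq_bigr => w _ do rewrite mulrDr mulr1.
  rewrite big_split -addrA /=; congr (_ + _).
  rewrite (bigD1 (-2)) //= addNr quadratic_character0 !mul0r add0r.
  rewrite [in RHS](bigD1 (-2)) //=.
  have -> : -2 - 2 = -1 * 2 ^+ 2 :> K by ring.
  rewrite quadratic_characterM quadratic_character_sq // mulr1 addrAC subrr add0r.
  apply: eq_bigr => w w2.
  have -> : w ^+ 2 - 4 = (w + 2) * (w - 2) by ring.
  have w20 : w + 2 != 0 by rewrite -[2]opprK subr_eq0.
  rewrite quadratic_characterM -[RHS]mul1r -(eta_sq _ w20).
  by ring.
rewrite subrK mulr2n mulrDl mul1r.
have shift a : `|\sum_w eta (w + a) * chi (c * w)| <= r.
  rewrite (reindex_inj (addIr (- a))) /=.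
  have e w : eta (w - a + a) * chi (c * (w - a)) = chi (- (c * a)) * (eta w * chi (w * c)).
    rewrite subrK; have -> : c * (w - a) = - (c * a) + w * c by ring.
    by rewrite chiP.2 mulrCA.
  under eq_bigr => w _ do rewrite e.
  by rewrite -mulr_sumr normrM character_norm // mul1r gauss_sum_bound.
by apply: (le_trans (ler_normD _ _)); rewrite lerD // shift.
Qed.

(** If [t b = c ^+ 2] with [b != 0], scaling [s] by [c / t] gives the diagonal case. If [t b] is not
    a square, [s -> 1 / s] followed by scaling by [b / t] shows that the sum is its own opposite.
    For [b = 0] it is a Gauss sum. *)
Lemma salie_bound (t b : K) : t != 0 ->
  `|\sum_(s | s != 0) eta s * chi (t * s + b / s)| <= 2 * r.
Proof.
move=> t0; have [->|b0] := eqVneq b 0.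
  have -> : \sum_(s | s != 0) eta s * chi (t * s + 0 / s) = \sum_w eta w * chi (w * t).
    rewrite [RHS](bigD1 0) //= quadratic_character0 mul0r add0r.
    by apply: eq_bigr => s _; rewrite mul0r addr0 [t * s]mulrC.
  by apply: (le_trans (gauss_sum_bound t0)); rewrite mulr_natl mulr2n lerDl.
have scale (a : K) : a != 0 -> \sum_(s | s != 0) eta s * chi (t * s + b / s) =
    eta a * \sum_(s | s != 0) eta s * chi (t * a * s + b / a / s).
  move=> a0; rewrite mulr_sumr (reindex_inj (mulfI a0)) /=; apply: eq_big => s.
    by rewrite mulf_eq0 (negPf a0).
  rewrite mulf_eq0 (negPf a0) /= => s0; rewrite quadratic_characterM mulrA.
  by congr (_ * chi _); field; rewrite a0 s0.
have [/existsP[c /eqP ctb]|ns] := boolP (is_square (t * b)).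
  have c0 : c != 0.
    by rewrite -sqrf_eq0 ctb mulf_neq0.
  have ct0 : c / t != 0 by rewrite mulf_neq0 // invr_eq0.
  rewrite (scale _ ct0) normrM quadratic_character_norm // mul1r.
  apply: le_trans (salie_diag_bound c0).
  rewrite le_eqVlt; apply/orP; left; apply/eqP; congr `|_|; apply: eq_bigr => s s0.
  congr (_ * chi _).
  have -> : b = c ^+ 2 / t by rewrite ctb mulrC mulKf.
  by field; rewrite c0 t0 s0.
set S := \sum_(s | _) _.
suff SN : S = - S.
  have /eqP : S *+ 2 = 0 by rewrite mulr2n {1}SN addNr.
  by rewrite mulrn_eq0 /= => /eqP ->; rewrite normr0 mulr_ge0.
have bt0 : b / t != 0 by rewrite mulf_neq0 // invr_eq0.
have inv_inj : injective (fun s : K => s^-1) by exact: invr_inj.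
rewrite {1}/S (reindex_inj inv_inj) /=.
have -> : \sum_(s : K | s^-1 != 0) eta s^-1 * chi (t * s^-1 + b / s^-1) =
   \sum_(s : K | s != 0) eta s * chi (b * s + t / s).
  apply: eq_big => s; first by rewrite invr_eq0.
  by rewrite invr_eq0 => s0; rewrite quadratic_characterV // invrK addrC.
rewrite /S (scale _ bt0).
have -> : eta (b / t) = -1.
  have -> : b / t = t * b * (t^-1) ^+ 2 by field.
  rewrite quadratic_characterM quadratic_character_sq ?invr_eq0 // mulr1.
  by rewrite /quadratic_character mulf_eq0 (negPf t0) (negPf b0) (negPf ns).
rewrite mulN1r opprK; apply: eq_bigr => s s0; congr (_ * chi _).
by field; rewrite t0 b0 s0.
Qed.

End OddCharacteristic.

Lemma kloosterman_scaled_bound (C : numClosedFieldType) (K : finFieldType)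
    (chi : K -> C) (r : C) (t b : K) :
  additive_character chi -> (exists x, chi x != 1) -> 0 <= r ->
  r ^+ 2 = #|K|%:R -> t != 0 ->
  `|\sum_(s | s != 0) chi (t * s + b / s)| <= 3 * r.
Proof.
move=> chiP chi1 r0 rK t0; have [->|b0] := eqVneq b 0.
  have := sum_character_mul t chiP chi1; rewrite (negPf t0) (bigD1 0) //= mul0r chiP.1.
  move/eqP; rewrite addrC addr_eq0 => /eqP e.
  under eq_bigr => s _ do rewrite mul0r addr0 mulrC.
  rewrite e normrN1; apply: (@le_trans _ _ r); last by rewrite ler_peMl // ler1n.
  by rewrite -[leLHS](expr1n _ 1) -(@expr_ge1 _ 2) // rK ler1n ltnW // finNzRing_gt1.
have -> : \sum_(s | s != 0) chi (t * s + b / s) = kloosterman chi (t * b).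
  rewrite /kloosterman [RHS](reindex_inj (mulfI t0)) /=; apply: eq_big => s.
    by rewrite mulf_eq0 (negPf t0).
  by move=> s0; congr (chi (_ + _)); field; rewrite t0 s0.
have := kloosterman_bound chiP chi1 (mulf_neq0 t0 b0).
rewrite -rK => h; rewrite -ler_sqr ?nnegrE ?mulr_ge0 // exprMn.
by apply: le_trans h _; rewrite -natrX.
Qed.

(** On nonzero arguments [H] is a combination [al + be * eta]: the Kloosterman part costs [3 h r]
    and the Salie part [2 h r]. If every element is a square, as in characteristic 2, [H] is
    constant there and the Kloosterman bound suffices. *)
Lemma square_invariant_sum (C : numClosedFieldType) (K : finFieldType)
    (chi : K -> C) (r h : C) (H : K -> C) (t b : K) :
  additive_character chi -> (exists x, chi x != 1) -> 0 <= r ->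
  r ^+ 2 = #|K|%:R -> t != 0 ->
  (forall c s, c != 0 -> H (c ^+ 2 * s) = H s) ->
  (forall s, s != 0 -> `|H s| <= h) ->
  `|\sum_(s | s != 0) H s * chi (t * s + b / s)| <= 5 * h * r.
Proof.
move=> chiP chi1 r0 rK t0 Hsq Hh.
have h0 : 0 <= h by apply: le_trans (Hh 1 (oner_neq0 _)).
have Hone s : s != 0 -> is_square s -> H s = H 1.
  move=> s0 /existsP[y /eqP ys]; rewrite -ys -[y ^+ 2]mulr1 Hsq //.
  by apply: contraNneq s0 => y0; rewrite -ys y0 expr0n.
have kl := kloosterman_scaled_bound b chiP chi1 r0 rK t0.
case: (pickP [pred g : K | ~~ is_square g]) => [g /= ng|sq]; last first.
  rewrite (eq_bigr (fun s => H 1 * chi (t * s + b / s))); last first.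
    by move=> s s0; rewrite Hone //; have /negbFE := sq s.
  rewrite -mulr_sumr normrM.
  apply: (@le_trans _ _ (h * (3 * r))).
    by rewrite ler_pM // Hh // oner_neq0.
  have -> : 5 * h * r = h * (3 * r) + h * (2 * r) by ring.
  by rewrite lerDl !mulr_ge0.
have K2 : 2 != 0 :> K by apply: contraNneq ng => /square_char2; apply.
have g0 : g != 0.
  by apply: contraNneq ng => ->; apply/existsP; exists 0; rewrite expr0n.
pose al := (H 1 + H g) / 2; pose be := (H 1 - H g) / 2.
have two0 : 0 < 2 :> C by rewrite ltr0n.
have bnd (e : C) : `|e| <= 2 * h -> `|e / 2| <= h.
  move=> eh; rewrite normrM normfV [`|2|]gtr0_norm // ler_pdivrMr //.
  by rewrite mulrC.
have al_h : `|al| <= h.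
  apply: bnd; apply: (le_trans (ler_normD _ _)).
  by rewrite mulr_natl mulr2n lerD // Hh // oner_neq0.
have be_h : `|be| <= h.
  apply: bnd; apply: (le_trans (ler_normB _ _)).
  by rewrite mulr_natl mulr2n lerD // Hh // oner_neq0.
have HE s : s != 0 -> H s = al + be * quadratic_character C s.
  move=> s0; rewrite /quadratic_character (negPf s0).
  have [/(Hone _ s0) ->|ns] := boolP (is_square s); first by rewrite /al /be; field.
  have [y /eqP yE] := existsP (nonsquare_mul C K2 ng ns).
  have -> : H s = H g; last by rewrite /al /be; field.
  have -> : s = (y / g) ^+ 2 * g by rewrite expr_div_n yE; field.
  rewrite Hsq // mulf_neq0 ?invr_eq0 //.
  by rewrite -sqrf_eq0 yE mulf_neq0.
have -> : \sum_(s | s != 0) H s * chi (t * s + b / s) =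
  al * (\sum_(s | s != 0) chi (t * s + b / s)) +
  be * (\sum_(s | s != 0) quadratic_character C s * chi (t * s + b / s)).
  rewrite !mulr_sumr -big_split /=; apply: eq_bigr => s s0.
  by rewrite HE // mulrDl mulrA.
clear HE; move: (al) (be) al_h be_h => {}al {}be al_h be_h.
apply: (le_trans (ler_normD _ _)); rewrite !normrM.
have -> : 5 * h * r = h * (3 * r) + h * (2 * r) by ring.
by apply: lerD; apply: ler_pM => //; exact: (salie_bound K2 chiP chi1 r0 rK b t0).
Qed.

(** * Fourier transform of a quadric *)

Section Dotp.
Variables (F : finFieldType) (d : nat).
Implicit Types x y z : 'rV[F]_d.

Lemma dotpC x y : dotp x y = dotp y x.
Proof. by apply: eq_bigr => i _; rewrite mulrC. Qed.

Lemma dotpDr x y z : dotp x (y + z) = dotp x y + dotp x z.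
Proof. by rewrite -big_split; apply: eq_bigr => i _; rewrite mxE mulrDr. Qed.

Lemma dotpZr a x y : dotp x (a *: y) = a * dotp x y.
Proof. by rewrite mulr_sumr; apply: eq_bigr => i _; rewrite mxE mulrCA. Qed.

Lemma dotp0r x : dotp x 0 = 0.
Proof. by rewrite -(scale0r (0 : 'rV[F]_d)) dotpZr mul0r. Qed.

Lemma dotpNr x y : dotp x (- y) = - dotp x y.
Proof. by rewrite -scaleN1r dotpZr mulN1r. Qed.

Lemma dotpDl x y z : dotp (x + y) z = dotp x z + dotp y z.
Proof. by rewrite !(dotpC _ z) dotpDr. Qed.

Lemma dotpNl x y : dotp (- x) y = - dotp x y.
Proof. by rewrite !(dotpC _ y) dotpNr. Qed.

Lemma dotp0l x : dotp 0 x = 0.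
Proof. by rewrite dotpC dotp0r. Qed.

Lemma dotp_nondegenerate x : x != 0 -> exists y, dotp x y != 0.
Proof.
case/rV0Pn => i xi; exists (delta_mx 0 i).
rewrite /dotp (bigD1 i) //= big1 ?addr0 => [|j ji]; rewrite mxE eqxx /=.
  by rewrite eqxx mulr1.
by rewrite (negPf ji) mulr0.
Qed.

Lemma card_rowV : #|{: 'rV[F]_d}| = (#|F| ^ d)%N.
Proof. by rewrite card_mx mul1n. Qed.

End Dotp.

Section Fourier.
Variables (C : numClosedFieldType) (F : finFieldType) (d : nat) (chi : F -> C).
Hypothesis chiP : additive_character chi.
Hypothesis chi1 : exists x, chi x != 1.

Lemma sum_character_linear (L : 'rV[F]_d -> F) : (forall a x, L (a *: x) = a * L x) ->
  {morph L : x y / x + y} -> (exists x, L x != 0) -> \sum_x chi (L x) = 0.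
Proof.
move=> LZ LD [y Ly]; have [chi0 chiD] := chiP.
apply: (sum_character (chi := fun x => chi (L x))).
  by split=> [|x z]; rewrite ?LD ?chiD // -(scale0r y) LZ mul0r.
have [a a1] := chi1; exists ((a / L y) *: y); by rewrite LZ divfK.
Qed.

Lemma sum_character_dotp (m : 'rV[F]_d) :
  \sum_x chi (dotp m x) = if m == 0 then #|F|%:R ^+ d else 0.
Proof.
have [->|m0] := eqVneq m 0.
  under eq_bigr => x _ do rewrite dotp0l chiP.1.
  by rewrite sumr_const card_rowV natrX.
apply: sum_character_linear; [by move=> a x; exact: dotpZr|by move=> x y; exact: dotpDr|].
exact: dotp_nondegenerate.
Qed.

Variables (Q : 'rV[F]_d -> F) (r : C).
Hypothesis QP : nondegenerate_quadratic_form Q.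
Hypothesis r_ge0 : 0 <= r.
Hypothesis r_sq : r ^+ 2 = #|F|%:R.

Let QZ a x : Q (a *: x) = a ^+ 2 * Q x. Proof. by case: QP => [[]]. Qed.
Let Q0 : Q 0 = 0. Proof. by rewrite -(scale0r 0) QZ expr0n mul0r. Qed.
Let B := polar Q.
Let BC x y : B x y = B y x.
Proof. by rewrite /B /polar addrC addrAC [y + x]addrC; ring. Qed.
Let Blin y : scalar (fun x => B x y). Proof. by case: QP => [[_]]. Qed.
Let BD x y z : B (x + y) z = B x z + B y z.
Proof. by have := Blin z 1 x y; rewrite scale1r mul1r. Qed.
Let B0 y : B 0 y = 0. Proof. by rewrite /B /polar add0r Q0 subr0 subrr. Qed.
Let BZ a x z : B (a *: x) z = a * B x z.
Proof. by have := Blin z a x 0; rewrite !addr0 B0 addr0. Qed.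
Let QD x y : Q (x + y) = Q x + Q y + B x y. Proof. by rewrite /B /polar; ring. Qed.

Let radical := [pred y | [forall x, B x y == 0]].

Definition gauss_quadratic (s : F) (m : 'rV[F]_d) : C :=
  \sum_x chi (s * Q x + dotp m x).
Local Notation G := gauss_quadratic.

(** In the double sum over [x] and [x + y] the phase is affine in [x] with linear part [s * B x y],
    so only [y] in the radical contributes. *)
Lemma gauss_quadratic_normsq s m : s != 0 ->
  `|G s m| ^+ 2 = #|F|%:R ^+ d * \sum_(y | y \in radical) chi (s * Q y + dotp m y).
Proof.
move=> s0; rewrite normCK mulrC rmorph_sum mulr_suml /=.
under eq_bigr => x _ do rewrite mulr_sumr (reindex_inj (addIr x)) /=.
rewrite exchange_big mulr_sumr [RHS]big_mkcond /=; apply: eq_bigr => y _.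
have e x : (chi (s * Q x + dotp m x))^* * chi (s * Q (y + x) + dotp m (y + x)) =
   chi (s * Q y + dotp m y) * chi (s * B x y).
  by rewrite -characterN // -!chiP.2 QD dotpDr (BC y x); congr chi; ring.
under eq_bigr => x _ do rewrite e.
rewrite -mulr_sumr.
have [yr|yr] := boolP (y \in radical).
  rewrite mulrC; congr (_ * _).
  under eq_bigr => x _ do rewrite (eqP (forallP yr x)) mulr0 chiP.1.
  by rewrite sumr_const card_rowV natrX.
rewrite (sum_character_linear (L := fun x => s * B x y)) ?mulr0 //.
- by move=> a x; rewrite BZ mulrCA.
- by move=> x z /=; rewrite BD mulrDr.
move: yr; rewrite inE => /forallPn[x Bxy]; exists x; by rewrite mulf_neq0.
Qed.

Section TrivialRadical.
Hypothesis rad0 : forall y, y \in radical -> y = 0.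

Let norm_gauss s m : s != 0 -> `|G s m| = r ^+ d.
Proof.
move=> s0; apply/eqP; rewrite -(@eqrXn2 _ 2) // ?exprn_ge0 //.
rewrite gauss_quadratic_normsq // -exprM mulnC exprM r_sq.
rewrite (big_pred1 0) ?Q0 ?dotp0r ?mulr0 ?addr0 ?chiP.1 ?mulr1 // => y.
apply/idP/eqP => [/rad0//|->]; apply/forallP => x.
by rewrite BC B0.
Qed.

(** With trivial radical, [w -> (B (e i) w)_i] is an injective self-map of a finite set, hence onto.
    Such a [w] is what completing the square requires. *)
Lemma polar_represents m : exists w, forall x, B x w = dotp m x.
Proof.
pose e (i : 'I_d) : 'rV[F]_d := delta_mx 0 i.
pose ev (w : 'rV[F]_d) : 'rV[F]_d := \row_i B (e i) w.
have BE x w : B x w = \sum_i x 0 i * B (e i) w.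
  rewrite {1}[x]row_sum_delta.
  rewrite (big_morph (fun u => B u w) (fun u v => BD u v w) (B0 w)).
  by apply: eq_bigr => i _; rewrite BZ.
have inj : injective ev.
  move=> w w' /rowP eww; apply/eqP; rewrite -subr_eq0; apply/eqP/rad0.
  apply/forallP => x; rewrite BC BD -scaleN1r BZ mulN1r subr_eq0 !(BC _ x) !BE.
  by apply/eqP/eq_bigr => i _; have := eww i; rewrite !mxE => ->.
have /codomP[w wE] := injF_onto inj m.
exists w => x; rewrite BE; apply: eq_bigr => i _.
by rewrite wE mxE mulrC.
Qed.

(** Shifting [x] by [w / s] gives [G s m = chi (- Q w / s) * G s 0], and [G s 0] depends only on the
    square class of [s], by [x -> c x]. So [square_invariant_sum] applies with [h = r ^+ d]. *)
Lemma gauss_sum_trivial_radical t m : t != 0 ->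
  `|\sum_(s | s != 0) chi (- (s * t)) * G s m| <= 5 * r ^+ d.+1.
Proof.
move=> t0; have [w wE] := polar_represents m.
have e s : s != 0 -> chi (- (s * t)) * G s m = G s 0 * chi (- t * s + - Q w / s).
  move=> s0; have -> : G s m = chi (- Q w / s) * G s 0.
    rewrite /G mulr_sumr [in RHS](reindex_inj (addIr (s^-1 *: w))) /=.
    apply: eq_bigr => x _; rewrite -chiP.2 dotp0l addr0 QD QZ BC BZ BC wE.
    by congr chi; field.
  have -> : - t * s = - (s * t) by ring.
  by rewrite chiP.2; ring.
rewrite (eq_bigr _ e).
rewrite exprSr mulrA; apply: square_invariant_sum => //.
- by rewrite oppr_eq0.
- move=> c s c0; rewrite /G [RHS](reindex_inj (scalerI c0)) /=.
  apply: eq_bigr => x _; rewrite !dotp0l QZ; congr chi; ring.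
by move=> s s0; rewrite norm_gauss.
Qed.

End TrivialRadical.

(* Only possible in characteristic 2: the radical is then a line on which
   [chi (s * Q _ + dotp m _)] is an additive character, trivial for at most one [s]. *)
Lemma gauss_sum_radical (y0 : 'rV[F]_d) t m : y0 \in radical -> y0 != 0 ->
  `|\sum_(s | s != 0) chi (- (s * t)) * G s m| <= r ^+ d.+1.
Proof.
move=> y0r y00.
have radP y : y \in radical -> forall x, B x y = 0.
  by move=> /forallP yr x; apply/eqP.
have Qn0 y : y \in radical -> Q y = 0 -> y = 0.
  by move=> /radP yr; apply: QP.2 => x; rewrite -/(B _ _) BC yr.
have Qy0 : Q y0 != 0 by apply: contraNneq y00 => /(Qn0 _ y0r) ->.
(* [B y0 y0 = 2 Q y0] vanishes on the radical while [Q y0] does not. *)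
have two0 : 2 = 0 :> F.
  apply: (mulIf Qy0); rewrite mul0r -(radP _ y0r y0) /B /polar.
  have -> : y0 + y0 = 2 *: y0 by rewrite scaler_nat mulr2n.
  by rewrite QZ; ring.
(* Choosing [c ^+ 2 = Q y / Q y0] makes [Q] vanish at [y - c *: y0], because [Q] is additive on the
   radical. *)
have radE y : y \in radical -> exists c, y = c *: y0.
  move=> yr; have /existsP[c /eqP cE] := square_char2 (Q y / Q y0) two0.
  exists c; apply/eqP; rewrite -subr_eq0; apply/eqP/Qn0.
    apply/forallP => x; rewrite BC BD -scaleN1r scalerA BZ.
    by rewrite !(BC _ x) (radP _ yr) (radP _ y0r) mulr0 addr0.
  rewrite QD -scaleN1r scalerA QZ exprMn sqrrN expr1n mul1r cE divfK // BC BZ.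
  rewrite (BC y0) (radP _ y0r) mulr0 addr0 -mulr2n -mulr_natl two0 mul0r //.
have y0Z_rad c : c *: y0 \in radical.
  by apply/forallP => x; rewrite BC BZ BC (radP _ y0r) mulr0.
pose psi s c := chi (s * (c ^+ 2 * Q y0) + c * dotp m y0).
have psiP s : additive_character (psi s).
  split=> [|c c']; rewrite /psi; first by rewrite expr0n !mul0r mulr0 addr0 chiP.1.
  rewrite -chiP.2; congr chi.
  have -> : (c + c') ^+ 2 = c ^+ 2 + c' ^+ 2 + 2 * (c * c') by ring.
  by rewrite two0; ring.
have radsum s : \sum_(y | y \in radical) chi (s * Q y + dotp m y) = \sum_c psi s c.
  have injZ : injective (fun c : F => c *: y0).
    move=> c c' /eqP; rewrite -subr_eq0 -scalerBl scaler_eq0 (negPf y00) orbF subr_eq0.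
    by move/eqP.
  rewrite (eq_bigl (mem ((fun c : F => c *: y0) @: F))).
    by rewrite big_imset /=; [apply: eq_bigr => c _; rewrite /psi QZ dotpZr|move=> ? ? _ _ /injZ].
  move=> y; apply/idP/imsetP => [/radE[c ->]|[c _ ->]]; first by exists c.
  exact: y0Z_rad.
pose triv s := [forall c, psi s c == 1].
have Gnorm s : s != 0 -> `|G s m| <= if triv s then r ^+ d.+1 else 0.
  move=> s0; have := gauss_quadratic_normsq m s0; rewrite radsum.
  case: ifP => [/forallP ts|/negbT/forallPn ns] e.
    rewrite -ler_sqr ?nnegrE ?exprn_ge0 // e.
    rewrite (eq_bigr (fun=> 1)); last by move=> c _; apply/eqP.
    by rewrite sumr_const -exprM mulnC exprM r_sq exprSr.
  rewrite -(@ler_sqr _ `|_|) ?nnegrE // e sum_character ?mulr0 ?expr0n //.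
(* Otherwise [chi ((s - s') * c ^+ 2 * Q y0) = 1] for all [c]; as every element is a square, [chi]
   would be trivial. *)
have triv_uniq s s' : triv s -> triv s' -> s = s'.
  move=> /forallP ts /forallP ts'; apply/eqP; rewrite -subr_eq0; apply/negPn/negP => ss.
  have [a] := chi1; apply/negP; rewrite negbK.
  have /existsP[c /eqP cE] := square_char2 (a / ((s - s') * Q y0)) two0.
  have -> : a = s * (c ^+ 2 * Q y0) + c * dotp m y0 - (s' * (c ^+ 2 * Q y0) + c * dotp m y0).
    by rewrite cE; field; rewrite ss Qy0.
  by rewrite chiP.2 characterN // -/(psi s c) -/(psi s' c) (eqP (ts c)) (eqP (ts' c)) rmorph1 mulr1.
apply: (le_trans (ler_norm_sum _ _ _)).
apply: (@le_trans _ _ (\sum_(s | s != 0) if triv s then r ^+ d.+1 else 0)).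
  by apply: ler_sum => s s0; rewrite normrM character_norm // mul1r Gnorm.
rewrite -big_mkcondr /=.
case: (pickP [pred s | (s != 0) && triv s]) => [s1 /= Ps1|no].
  have /andP[_ t1] := Ps1; rewrite (bigD1 s1) //= big1 ?addr0 // => s /andP[/andP[_ ts]].
  by rewrite (triv_uniq _ _ ts t1) eqxx.
by rewrite big_pred0 // exprn_ge0.
Qed.

Lemma gauss_sum_bound_all t m : t != 0 ->
  `|\sum_(s | s != 0) chi (- (s * t)) * G s m| <= 5 * r ^+ d.+1.
Proof.
move=> t0.
case: (pickP [pred y | (y \in radical) && (y != 0)]) => [y /= /andP[yr y0]|no].
  apply: (le_trans (gauss_sum_radical t m yr y0)).
  by rewrite ler_peMl ?exprn_ge0 // ler1n.
apply: gauss_sum_trivial_radical => // y yr.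
by have := no y; rewrite /= yr /= => /negbFE/eqP.
Qed.

(** Detecting [Q y = t] by the characters [chi (s * _)], the frequency [s = 0] gives exactly the
    subtracted term. *)
Lemma quadric_fourier_bound (t : F) (m : 'rV[F]_d) : t != 0 ->
  `|#|F|%:R * (\sum_(y | Q y == t) chi (dotp m y)) -
    (if m == 0 then #|F|%:R ^+ d else 0)| <= 5 * r ^+ d.+1.
Proof.
move=> t0; rewrite -sum_character_dotp.
have -> : #|F|%:R * (\sum_(y | Q y == t) chi (dotp m y)) =
   \sum_s \sum_y chi (s * (Q y - t)) * chi (dotp m y).
  rewrite exchange_big mulr_sumr [LHS]big_mkcond /=; apply: eq_bigr => y _.
  by rewrite -mulr_suml (sum_character_mul _ chiP chi1) subr_eq0; case: eqP; rewrite ?mul0r.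
rewrite (bigD1 0) //=.
have -> : \sum_y chi (0 * (Q y - t)) * chi (dotp m y) = \sum_x chi (dotp m x).
  by apply: eq_bigr => y _; rewrite mul0r chiP.1 mul1r.
rewrite addrAC subrr add0r.
rewrite (eq_bigr (fun s => chi (- (s * t)) * G s m)); first exact: gauss_sum_bound_all.
move=> s _; rewrite mulr_sumr; apply: eq_bigr => y _.
by rewrite -!chiP.2; congr chi; ring.
Qed.
End Fourier.

(** * Moments of the exponential sum of a subset of a regular set *)

Lemma real_AGM2 (C : numDomainType) (x y : C) : x \is Num.real -> y \is Num.real ->
  2 * (x * y) <= x ^+ 2 + y ^+ 2.
Proof.
move=> xr yr; rewrite -subr_ge0.
have -> : x ^+ 2 + y ^+ 2 - 2 * (x * y) = (x - y) ^+ 2 by ring.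
by rewrite real_exprn_even_ge0 // rpredB.
Qed.

(** The constants of [moment_even_bound], with the recursion dictated by [moment_recursion]. The
    ring is arbitrary because they occur both over [C] and over the reals. *)
Fixpoint moment_const (T : pzRingType) (c : T) (j : nat) : T :=
  if j is i.+1 then 2 * c + c ^+ 2 * moment_const c i else 1.

Lemma moment_const_ge0 (T : numDomainType) (c : T) (j : nat) :
  0 <= c -> 0 <= moment_const c j.
Proof. by move=> c0; elim: j => //= j IH; rewrite addr_ge0 ?mulr_ge0 ?exprn_ge0. Qed.

Section Moments.
Variables (C : numClosedFieldType) (F : finFieldType) (d : nat) (chi : F -> C).
Hypothesis chiP : additive_character chi.
Hypothesis chi1 : exists x, chi x != 1.
Local Notation q := (#|F|%:R : C).
Local Notation V := ('rV[F]_d).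

Definition exp_sum (A : {set V}) (m : V) : C := \sum_(x in A) chi (dotp m x).

Lemma exp_sum0 (A : {set V}) : exp_sum A 0 = #|A|%:R.
Proof.
by rewrite -sumr_const; apply: eq_bigr => x _; rewrite dotp0l chiP.1.
Qed.

Lemma exp_sumX (A : {set V}) (m : V) (k : nat) : exp_sum A m ^+ k =
  \sum_(x : {ffun 'I_k -> V} | [forall i, x i \in A]) chi (dotp m (\sum_i x i)).
Proof.
rewrite -[k in LHS]card_ord -prodr_const (eq_bigl xpredT) //.
rewrite bigA_distr_big /=; apply: eq_big => [x|x _].
  by apply/ffun_onP/forallP.
rewrite (big_morph (dotp m) (dotpDr m) (dotp0r m)).
by rewrite (big_morph chi chiP.2 chiP.1).
Qed.

Lemma count_fourier (k : nat) (Q : V -> F) (E : {set V}) (t : F) :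
  q ^+ d * #|sum_solutions k Q E t|%:R =
  \sum_m (\sum_(y | Q y == t) chi (dotp (- m) y)) * exp_sum E m ^+ k.
Proof.
transitivity (\sum_(x : {ffun 'I_k -> V} | [forall i, x i \in E])
    \sum_(y | Q y == t) \sum_m chi (dotp m (\sum_i x i - y))); last first.
  rewrite (eq_bigr (fun x => \sum_m \sum_(y | Q y == t) chi (dotp (- m) y) *
      chi (dotp m (\sum_i (x : {ffun 'I_k -> V}) i)))); last first.
    move=> x _; rewrite exchange_big; apply: eq_bigr => m _; apply: eq_bigr => y _.
    by rewrite -chiP.2 dotpDr dotpNr dotpNl addrC.
  rewrite exchange_big; apply: eq_bigr => m _; rewrite exp_sumX mulr_sumr.
  by apply: eq_bigr => x _; rewrite mulr_suml.
have inner z : \sum_(y | Q y == t) \sum_m chi (dotp m (z - y)) =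
    if Q z == t then q ^+ d else 0.
  have e y : \sum_m chi (dotp m (z - y)) = if y == z then q ^+ d else 0.
    under eq_bigr => m _ do rewrite dotpC.
    by rewrite sum_character_dotp // subr_eq0 eq_sym.
  rewrite (eq_bigr _ (fun y _ => e y)) -big_mkcondr /=.
  case: ifP => Qz; last first.
    by rewrite big_pred0 // => y; apply/andP => -[Qy /eqP yz]; rewrite -yz Qy in Qz.
  by rewrite (big_pred1 z) // => y; rewrite /= andb_idl // => /eqP ->.
rewrite (eq_bigr _ (fun x _ => inner _)) -big_mkcondr /= sumr_const mulr_natr.
by congr (_ *+ _); apply: eq_card => x; rewrite inE.
Qed.

Definition moment (E : {set V}) (j : nat) : C :=
  \sum_(m | m != 0) `|exp_sum E m| ^+ j.

Lemma moment_ge0 E j : 0 <= moment E j.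
Proof. by apply: sumr_ge0 => m _; rewrite exprn_ge0. Qed.

Lemma parseval (E : {set V}) : \sum_m `|exp_sum E m| ^+ 2 = q ^+ d * #|E|%:R.
Proof.
have e m : `|exp_sum E m| ^+ 2 =
    \sum_(x in E) \sum_(y in E) chi (dotp m (x - y)).
  rewrite normCK /exp_sum rmorph_sum mulr_suml /=; apply: eq_bigr => x _.
  rewrite mulr_sumr; apply: eq_bigr => y _.
  by rewrite -characterN // -chiP.2 dotpDr dotpNr.
rewrite (eq_bigr _ (fun m _ => e m)) exchange_big /=.
transitivity (\sum_(x in E) q ^+ d); last by rewrite sumr_const mulr_natr.
apply: eq_bigr => x xE; rewrite exchange_big /= (bigD1 x) //= [X in _ + X]big1 ?addr0.
  under eq_bigr => m _ do rewrite dotpC.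
  by rewrite sum_character_dotp // subrr eqxx.
move=> y /andP[_ yx]; under eq_bigr => m _ do rewrite dotpC.
by rewrite sum_character_dotp // subr_eq0 eq_sym (negPf yx).
Qed.

(** Nonnegativity of the inverse Fourier transform [w], which is Bochner's description of positive
    definite functions. *)
Definition positive_definite (g : V -> C) : Prop :=
  exists2 w : V -> C, forall y, 0 <= w y & forall m, g m = \sum_y w y * chi (dotp m y).

Lemma positive_definite1 : positive_definite (fun=> 1).
Proof.
exists (fun y => (y == 0)%:R) => [y|m]; first exact: ler0n.
rewrite (bigD1 0) //= eqxx mul1r dotp0r chiP.1 big1 ?addr0 // => y /negPf ->.
by rewrite mul0r.
Qed.

(** The weight of the product is the convolution of the weights. *)
Lemma positive_definiteM g h : positive_definite g -> positive_definite h ->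
  positive_definite (fun m => g m * h m).
Proof.
move=> [v v0 gE] [w w0 hE].
exists (fun z => \sum_y v y * w (z - y)) => [z|m].
  by apply: sumr_ge0 => y _; rewrite mulr_ge0.
rewrite gE hE mulr_suml.
under [RHS]eq_bigr => z _ do rewrite mulr_suml.
rewrite [RHS]exchange_big /=; apply: eq_bigr => y _.
rewrite mulr_sumr [RHS](reindex_inj (addIr y)) /=; apply: eq_bigr => z _.
by rewrite addrK dotpDr chiP.2; ring.
Qed.

Lemma positive_definite_exp_sum E : positive_definite (exp_sum E).
Proof.
exists (fun y => (y \in E)%:R) => [y|m]; first exact: ler0n.
rewrite /exp_sum big_mkcond; apply: eq_bigr => y _.
by case: ifP => _; rewrite ?mul1r ?mul0r.
Qed.

Lemma positive_definite_conj g : positive_definite g ->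
  positive_definite (fun m => (g m)^*).
Proof.
move=> [w w0 gE]; exists (fun y => w (- y)) => // m.
rewrite gE rmorph_sum [RHS](reindex_inj oppr_inj) /=; apply: eq_bigr => y _.
by rewrite opprK dotpNr characterN // rmorphM /= (conj_Creal (ger0_real (w0 _))).
Qed.

(** By orthogonality the pairing with [exp_sum A] is [q ^+ d] times the total weight of [A], which
    is monotone in [A]. *)
Lemma positive_definite_pairing_le g (E W : {set V}) : positive_definite g ->
  E \subset W ->
  \sum_m g m * (exp_sum E m)^* <= \sum_m g m * (exp_sum W m)^*.
Proof.
move=> [w w0 gE] EW.
have pairE (A : {set V}) : \sum_m g m * (exp_sum A m)^* = q ^+ d * \sum_(x in A) w x.
  have e m : g m * (exp_sum A m)^* = \sum_(x in A) \sum_y w y * chi (dotp m (y - x)).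
    rewrite /exp_sum rmorph_sum mulr_sumr; apply: eq_bigr => x _.
    rewrite gE mulr_suml; apply: eq_bigr => y _.
    by rewrite -mulrA /= -characterN // -chiP.2 dotpDr dotpNr.
  rewrite (eq_bigr _ (fun m _ => e m)) exchange_big mulr_sumr /=.
  apply: eq_bigr => x _; rewrite exchange_big /= (bigD1 x) //= [X in _ + X]big1 ?addr0.
    rewrite -mulr_sumr mulrC; under eq_bigr => m _ do rewrite dotpC.
    by rewrite sum_character_dotp // subrr eqxx.
  move=> y yx; rewrite -mulr_sumr; under eq_bigr => m _ do rewrite dotpC.
  by rewrite sum_character_dotp // subr_eq0 (negPf yx) mulr0.
rewrite !pairE ler_wpM2l ?exprn_ge0 //.
rewrite [leRHS](big_setID E) /= (finset.setIidPr EW) lerDl.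
by apply: sumr_ge0 => x _.
Qed.

(** [W] stands for the regular variety and [a] for [q^((d-1)/2)]; without the factor [q^(-d)], the
    Fourier decay [q^(-(d+1)/2)] becomes a bound of order [a]. *)
Variables (c a : C) (E W : {set V}).
Hypothesis EW : E \subset W.
Hypothesis c_ge0 : 0 <= c.
Hypothesis a_gt0 : 0 < a.
Hypothesis card_W : #|W|%:R <= c * a ^+ 2.
Hypothesis W_regular : forall m, m != 0 -> `|exp_sum W m| <= c * a.
Hypothesis a_sq : q ^+ d = q * a ^+ 2.
Let n : C := #|E|%:R.
Let n_ge0 : 0 <= n. Proof. exact: ler0n. Qed.
Let a_ge0 : 0 <= a. Proof. exact: ltW. Qed.
Let A := moment E.

Lemma moment2_le : A 2 <= q * a ^+ 2 * n.
Proof.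
rewrite -a_sq -parseval [leRHS](bigD1 0) //= lerDr.
by rewrite exprn_ge0.
Qed.

(* The inverse transform of [|S|^(2j) S], for [S] the exponential sum of [E], is
   nonnegative, so its sum over [E] is at most its sum over [W]. *)
Lemma moment_even_odd j : A j.*2.+2 <= c * a ^+ 2 * n ^+ j.*2.+1 + c * a * A j.*2.+1.
Proof.
pose g m := (exp_sum E m * (exp_sum E m)^*) ^+ j * exp_sum E m.
have P1 := positive_definite_exp_sum E.
have powP i : positive_definite (fun m => (exp_sum E m * (exp_sum E m)^*) ^+ i).
  elim: i => [|i IH]; first exact: positive_definite1.
  have := positive_definiteM (positive_definiteM P1 (positive_definite_conj P1)) IH.
  by case=> w w0 wE; exists w => // m; rewrite exprS wE.
have gP : positive_definite g := positive_definiteM (powP j) P1.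
have gnorm m : `|g m| = `|exp_sum E m| ^+ j.*2.+1.
  rewrite /g normrM normrX -normCK normrX normr_id -exprM mul2n -exprSr //.
have le1 : A j.*2.+2 <= \sum_m g m * (exp_sum E m)^*.
  have e m : g m * (exp_sum E m)^* = `|exp_sum E m| ^+ j.*2.+2.
    by rewrite /g -mulrA -normCK -exprM -exprD mul2n addn2.
  rewrite (eq_bigr _ (fun m _ => e m)) [leRHS](bigD1 0) //= lerDr.
  by rewrite exprn_ge0.
have le2 := le_trans le1 (positive_definite_pairing_le gP EW).
have -> : A j.*2.+2 = `|A j.*2.+2| by rewrite ger0_norm ?moment_ge0.
have pos : 0 <= \sum_m g m * (exp_sum W m)^* by apply: le_trans le2; exact: moment_ge0.
apply: (@le_trans _ _ `|\sum_m g m * (exp_sum W m)^*|).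
  by rewrite !ger0_norm ?moment_ge0.
apply: (le_trans (ler_norm_sum _ _ _)); rewrite (bigD1 0) //=; apply: lerD.
  rewrite normrM norm_conjC gnorm !exp_sum0 !ger0_norm ?ler0n // mulrC.
  by rewrite ler_wpM2r ?exprn_ge0 ?ler0n.
rewrite mulr_sumr; apply: ler_sum => m m0.
rewrite normrM norm_conjC gnorm mulrC ler_wpM2r ?exprn_ge0 //.
exact: W_regular.
Qed.

(** AM-GM for [|S|] and [c a], weighted by [|S|^(2j+2)], bounds the odd moment of [moment_even_odd]
    by the two neighbouring even ones; half of the larger is absorbed on the left. *)
Lemma moment_recursion j : A j.+1.*2.+2 <=
  2 * c * a ^+ 2 * n ^+ j.+1.*2.+1 + c ^+ 2 * a ^+ 2 * A j.*2.+2.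
Proof.
set i := j.+1; have h := moment_even_odd i.
have amgm : 2 * (c * a * A i.*2.+1) <= A i.*2.+2 + c ^+ 2 * a ^+ 2 * A j.*2.+2.
  rewrite /A /moment !mulr_sumr -big_split /=; apply: ler_sum => m _.
  have xr : `|exp_sum E m| \is Num.real by rewrite normr_real.
  have yr : c * a \is Num.real by rewrite ger0_real // mulr_ge0.
  have e0 : 0 <= `|exp_sum E m| ^+ j.*2.+2 by rewrite exprn_ge0.
  have := ler_wpM2l e0 (real_AGM2 xr yr).
  move: (`|exp_sum E m|) => x /=.
  have -> : x ^+ j.*2.+2 * (2 * (x * (c * a))) = 2 * (c * a * x ^+ i.*2.+1).
    by rewrite /i doubleS [x ^+ j.*2.+3]exprSr; ring.
  have -> : x ^+ j.*2.+2 * (x ^+ 2 + (c * a) ^+ 2) =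
     x ^+ i.*2.+2 + c ^+ 2 * a ^+ 2 * x ^+ j.*2.+2.
    by rewrite /i doubleS [x ^+ j.*2.+4]exprSr [x ^+ j.*2.+3]exprSr; ring.
  by [].
have h2 : 2 * A i.*2.+2 <= 2 * (c * a ^+ 2 * n ^+ i.*2.+1) + 2 * (c * a * A i.*2.+1).
  by rewrite -mulrDr ler_wpM2l.
have := le_trans h2 (lerD (lexx _) amgm).
rewrite mulr_natl mulr2n addrA -(lerD2r (- A i.*2.+2)) addrK => /le_trans; apply.
by rewrite le_eqVlt; apply/orP; left; apply/eqP; ring.
Qed.

Hypothesis a_le_n : a <= n.

(** Induction from Parseval; [a <= n] absorbs the term [a^4 n^(2j+1)] produced by the recursion into
    [a^2 n^(2j+3)]. *)
Lemma moment_even_bound j : A j.*2.+2 <=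
  moment_const c j * (a ^+ 2 * n ^+ j.*2.+1 + q * a ^+ j.*2.+2 * n).
Proof.
elim: j => [|j IH] /=.
  rewrite mul1r; apply: (le_trans moment2_le).
  by rewrite lerDr mulr_ge0 ?exprn_ge0.
apply: (le_trans (moment_recursion j)).
apply: le_trans (lerD (lexx _) (ler_wpM2l _ IH)) _.
  by rewrite mulr_ge0 ?exprn_ge0.
have B0 := moment_const_ge0 j c_ge0; move: (moment_const c j) B0 => B B0.
rewrite doubleS.
have h : a ^+ 4 * n ^+ j.*2.+1 <= a ^+ 2 * n ^+ j.*2.+3.
  have -> : a ^+ 4 * n ^+ j.*2.+1 = a ^+ 2 * n ^+ j.*2.+1 * a ^+ 2 by ring.
  have -> : a ^+ 2 * n ^+ j.*2.+3 = a ^+ 2 * n ^+ j.*2.+1 * n ^+ 2.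
    have -> : n ^+ j.*2.+3 = n ^+ j.*2.+1 * n ^+ 2 by rewrite -exprD addn2.
    by ring.
  by rewrite ler_wpM2l ?mulr_ge0 ?exprn_ge0 // lerXn2r.
have h1 : c ^+ 2 * B * (a ^+ 4 * n ^+ j.*2.+1) <= c ^+ 2 * B * (a ^+ 2 * n ^+ j.*2.+3).
  by rewrite ler_wpM2l // mulr_ge0 ?exprn_ge0.
have -> : 2 * c * a ^+ 2 * n ^+ j.*2.+3 + c ^+ 2 * a ^+ 2 *
    (B * (a ^+ 2 * n ^+ j.*2.+1 + q * a ^+ j.*2.+2 * n)) =
  (2 * c * a ^+ 2 * n ^+ j.*2.+3 + c ^+ 2 * B * q * a ^+ j.*2.+4 * n) +
  c ^+ 2 * B * (a ^+ 4 * n ^+ j.*2.+1).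
  have -> : a ^+ j.*2.+4 = a ^+ j.*2.+2 * a ^+ 2 by rewrite -exprD addn2.
  by ring.
apply: (le_trans (lerD (lexx _) h1)).
rewrite -subr_ge0.
set R := (X in 0 <= X).
have -> : R = 2 * c * q * a ^+ j.*2.+4 * n by rewrite /R; ring.
apply: mulr_ge0; last exact: n_ge0.
apply: mulr_ge0; last exact: exprn_ge0.
by rewrite !mulr_ge0.
Qed.

Section AllMoments.
Variables (th u : C) (k : nat).
Hypothesis th_gt0 : 0 < th.
Hypothesis th_le1 : th <= 1.
Hypothesis k_ge3 : (3 <= k)%N.
Hypothesis u_ge0 : 0 <= u.
Hypothesis aE : a = u * n.
(** As [u = a / n], the second term is [(a q^(1/(k-1)) / n)^(k-1)], which the size hypothesis on [E]
    makes small. *)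
Let X : C := u + q * u ^+ k.-1.
(** [th] is a free AM-GM parameter serving odd [k]: once [X <= 2 th^2], [Y] is at most [3 th]. *)
Let Y : C := th + th^-1 * X.
Let B : C := moment_const c k./2.-1 + moment_const c k./2.

Let n_gt0 : 0 < n. Proof. exact: lt_le_trans a_le_n. Qed.
Let u_le1 : u <= 1. Proof. by rewrite -(ler_pM2r n_gt0) mul1r -aE. Qed.
Let X_ge0 : 0 <= X.
Proof. exact: addr_ge0 u_ge0 (mulr_ge0 (ler0n _ _) (exprn_ge0 _ u_ge0)). Qed.
Let thV_ge1 : 1 <= th^-1. Proof. by rewrite invf_ge1. Qed.
Let X_le : X <= th^-1 * X. Proof. exact: (ler_peMl X_ge0 thV_ge1). Qed.
Let X_le_Y : X <= Y.
Proof. by apply: (le_trans X_le); rewrite lerDr ltW. Qed.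

Let Y_ge0 : 0 <= Y. Proof. exact: le_trans X_ge0 X_le_Y. Qed.

(** For even [k] this is [moment_even_bound] with [a = u n]. For [k = 2j + 3], AM-GM interpolates
    between the even moments of orders [2j + 2] and [2j + 4]. *)
Lemma moment_bound : A k <= B * (a * n ^+ k * Y).
Proof.
have an_ge0 : 0 <= a * n ^+ k by rewrite mulr_ge0 ?exprn_ge0.
have [j [kE|kE]] : exists j, k = j.*2.+2 \/ k = j.*2.+3.
  exists (k - 2)./2; rewrite -{1 3}(subnKC (ltnW k_ge3)) -{1 3}(odd_double_half (k - 2)).
  by case: (odd _); [right|left].
  have kh : k./2 = j.+1 by rewrite kE /= doubleK.
  have B0 := moment_const_ge0 j c_ge0; have B1 := moment_const_ge0 j.+1 c_ge0.
  rewrite /B kh [_.-1]/= mulrDl.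
  apply: (@le_trans _ _ (moment_const c j * (a * n ^+ k * Y))); last first.
    by rewrite lerDl; exact: mulr_ge0 B1 (mulr_ge0 an_ge0 Y_ge0).
  rewrite {1}kE; apply: (le_trans (moment_even_bound j)); rewrite ler_wpM2l //.
  apply: (@le_trans _ _ (a * n ^+ k * X)); last by rewrite ler_wpM2l.
  rewrite /X kE [_.-1]/= aE !exprMn.
  have -> : n ^+ j.*2.+2 = n ^+ j.*2.+1 * n by rewrite exprSr.
  have -> : u ^+ j.*2.+2 = u ^+ j.*2.+1 * u by rewrite exprSr.
  by rewrite le_eqVlt; apply/orP; left; apply/eqP; ring.
have kh : k./2 = j.+1 by rewrite kE /= uphalf_double.
have B0 := moment_const_ge0 j c_ge0; have B1 := moment_const_ge0 j.+1 c_ge0.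
have le0 := moment_even_bound j; have le1 := moment_even_bound j.+1.
rewrite /B kh [_.-1]/=; move: (moment_const c j) (moment_const c j.+1) B0 B1 le0 le1.
move=> b0 b1 b0_ge0 b1_ge0 le0 le1.
(* With this weight, the main term [a^2 n^k] of the upper moment, divided by [w], yields the summand
   [th] of [Y]; [w] times the lower moment is of order [th^-1 * X]. *)
set w := a / th.
have w_gt0 : 0 < w by rewrite divr_gt0.
have amgm : 2 * w * A k <= A j.+1.*2.+2 + w ^+ 2 * A j.*2.+2.
  rewrite /A /moment !mulr_sumr -big_split /=; apply: ler_sum => m _.
  have xr : `|exp_sum E m| \is Num.real by rewrite normr_real.
  have yr : w \is Num.real by rewrite gtr0_real.
  have e0 : 0 <= `|exp_sum E m| ^+ j.*2.+2 by rewrite exprn_ge0.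
  have := ler_wpM2l e0 (real_AGM2 xr yr).
  move: (`|exp_sum E m|) => x; rewrite kE doubleS.
  have -> : x ^+ j.*2.+3 = x ^+ j.*2.+2 * x by rewrite exprSr.
  have -> : x ^+ j.*2.+4 = x ^+ j.*2.+2 * x ^+ 2 by rewrite -exprD addn2.
  have -> : x ^+ j.*2.+2 * (2 * (x * w)) = 2 * w * (x ^+ j.*2.+2 * x) by ring.
  have -> : x ^+ j.*2.+2 * (x ^+ 2 + w ^+ 2) =
    x ^+ j.*2.+2 * x ^+ 2 + w ^+ 2 * x ^+ j.*2.+2 by ring.
  by [].
set M := a * n ^+ k * Y.
have M_ge0 : 0 <= M := mulr_ge0 an_ge0 Y_ge0.
have p0 : w ^+ 2 * (a ^+ 2 * n ^+ j.*2.+1 + q * a ^+ j.*2.+2 * n) <= w * M.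
  rewrite expr2 -mulrA ler_wpM2l ?(ltW w_gt0) //.
  apply: (@le_trans _ _ (a * n ^+ k * (th^-1 * X))); last first.
    by rewrite ler_wpM2l // lerDr ltW.
  have -> : w * (a ^+ 2 * n ^+ j.*2.+1 + q * a ^+ j.*2.+2 * n) =
     a * n ^+ k * (th^-1 * (u ^+ 2 + q * u ^+ k.-1)).
    rewrite /w kE /= {2 3}aE !exprMn.
    have -> : n ^+ j.*2.+3 = n ^+ j.*2.+1 * n ^+ 2 by rewrite -exprD addn2.
    have -> : n ^+ j.*2.+2 = n ^+ j.*2.+1 * n by rewrite exprSr.
    by ring.
  apply: ler_wpM2l => //; apply: ler_wpM2l; first by rewrite invr_ge0 ltW.
  by rewrite /X lerD2r expr2 ler_piMl.
have p1 : a ^+ 2 * n ^+ j.+1.*2.+1 + q * a ^+ j.+1.*2.+2 * n <= w * M.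
  have -> : w * M = a ^+ 2 * n ^+ k * (1 + th^-1 ^+ 2 * X).
    by rewrite /w /M /Y; field; rewrite gt_eqF.
  have -> : a ^+ 2 * n ^+ j.+1.*2.+1 + q * a ^+ j.+1.*2.+2 * n =
      a ^+ 2 * n ^+ k * (1 + q * u ^+ k.-1).
    rewrite kE doubleS /=.
    have -> : a ^+ j.*2.+4 = a ^+ 2 * a ^+ j.*2.+2 by rewrite -exprD add2n.
    have -> : n ^+ j.*2.+3 = n ^+ j.*2.+2 * n by rewrite exprSr.
    by rewrite [in a ^+ j.*2.+2]aE exprMn; ring.
  rewrite ler_wpM2l ?mulr_ge0 ?exprn_ge0 // lerD2l.
  apply: (@le_trans _ _ X); first by rewrite lerDr.
  by rewrite ler_peMl // expr_ge1 // invr_ge0 ltW.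
have w2_gt0 : 0 < 2 * w by rewrite mulr_gt0.
rewrite -(ler_pM2l w2_gt0); apply: (le_trans amgm).
have q0 := ler_wpM2l b0_ge0 p0; have q1 := ler_wpM2l b1_ge0 p1.
have h1 := le_trans le1 q1.
have h0 : w ^+ 2 * A j.*2.+2 <= b0 * (w * M).
  apply: le_trans q0; rewrite mulrCA; rewrite ler_wpM2l // exprn_ge0 // ltW //.
apply: (le_trans (lerD h1 h0)).
have -> : 2 * w * ((b0 + b1) * M) = (b1 * (w * M) + b0 * (w * M)) + (b0 + b1) * (w * M) by ring.
by rewrite lerDl; apply: mulr_ge0 (addr_ge0 b0_ge0 b1_ge0) (mulr_ge0 (ltW w_gt0) M_ge0).
Qed.

Variables (Q : V -> F) (t : F) (r : C).
Hypothesis QP : nondegenerate_quadratic_form Q.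
Hypothesis t0 : t != 0.
Hypothesis r_gt0 : 0 < r.
Hypothesis r_sq : r ^+ 2 = q.
Hypothesis d_gt0 : (0 < d)%N.
Hypothesis a_r : a = r ^+ d.-1.
Let N : C := #|sum_solutions k Q E t|%:R.

(** The Fourier expansion of the count has main term [n^k] from [m = 0]. The quadric contributes an
    error of at most [5 r^(d+1) = 5 q^d / a] at every frequency, [m = 0] included, whence
    [n^k + A k]. *)
Lemma count_error : `|q * N - n ^+ k| * a <= 5 * (n ^+ k + A k).
Proof.
have rd0 : 0 < r ^+ d.+1 by rewrite exprn_gt0.
have qd : q ^+ d = r ^+ d.+1 * a.
  by rewrite a_r -r_sq -exprM -exprD addSnnS prednK // addnn mul2n.
pose ep (m : V) : C := q * (\sum_(y | Q y == t) chi (dotp m y)) -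
    (if m == 0 then q ^+ d else 0).
have epP m : `|ep m| <= 5 * r ^+ d.+1.
  exact: (quadric_fourier_bound chiP chi1 QP (ltW r_gt0) r_sq m t0).
have key : q ^+ d * (q * N - n ^+ k) = \sum_m ep (- m) * exp_sum E m ^+ k.
  rewrite mulrBr mulrCA count_fourier mulr_sumr.
  have -> : q ^+ d * n ^+ k = \sum_m (if m == 0 then q ^+ d else 0) * exp_sum E m ^+ k.
    rewrite (bigD1 0) //= eqxx exp_sum0 big1 ?addr0 // => m /negPf ->.
    by rewrite mul0r.
  rewrite -sumrB; apply: eq_bigr => m _.
  by rewrite /ep oppr_eq0 mulrBl mulrA.
rewrite -(ler_pM2l rd0) mulrCA -qd mulrC -[q ^+ d]ger0_norm ?exprn_ge0 // -normrM key.
apply: (le_trans (ler_norm_sum _ _ _)).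
have -> : r ^+ d.+1 * (5 * (n ^+ k + A k)) =
    \sum_m 5 * r ^+ d.+1 * `|exp_sum E m| ^+ k.
  rewrite -mulr_sumr (bigD1 0) //= exp_sum0 normr_nat.
  by rewrite -/n -[X in _ + X]/(A k); ring.
by apply: ler_sum => m _; rewrite normrM normrX ler_wpM2r ?exprn_ge0.
Qed.

(** The error [n^k / a] at frequency zero is absorbed as well: [n <= #|W| <= c a^2] gives
    [1 <= c a u <= c a Y]. *)
Lemma relative_error : `|q * N - n ^+ k| <= 5 * (c + B) * Y * n ^+ k.
Proof.
have caY : 1 <= c * a * Y.
  apply: (@le_trans _ _ (c * a * u)); last first.
    rewrite ler_wpM2l ?mulr_ge0 // (le_trans _ X_le_Y) // lerDl.
    by rewrite mulr_ge0 ?exprn_ge0.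
  rewrite -(ler_pM2r n_gt0) mul1r -[_ * u * n]mulrA -aE -mulrA -expr2.
  by apply: le_trans card_W; rewrite ler_nat subset_leq_card.
rewrite -(ler_pM2r a_gt0); apply: (le_trans count_error).
have -> : 5 * (c + B) * Y * n ^+ k * a =
  5 * (c * a * Y * n ^+ k + B * (a * n ^+ k * Y)) by ring.
rewrite ler_wpM2l // lerD ?moment_bound //.
by rewrite ler_peMl ?exprn_ge0.
Qed.

End AllMoments.

End Moments.

(** * Transfer of the error bound to real numbers *)

Local Open Scope complex_scope.

Section Transfer.
Variables (R : realType) (F : finFieldType) (d k : nat).
Variables (chi : F -> R[i]) (Q : 'rV[F]_d -> F) (E W : {set 'rV[F]_d}) (t : F).
Variables (c th u : R).
Let q : R := #|F|%:R.
Let s : R := Num.sqrt q.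
Let n : R := #|E|%:R.
Hypothesis chiP : nontrivial_additive_character chi.
Hypothesis QP : nondegenerate_quadratic_form Q.
Hypothesis t0 : t != 0.
Hypothesis d_gt0 : (0 < d)%N.
Hypothesis k_ge3 : (3 <= k)%N.
Hypothesis EW : E \subset W.
Hypothesis c_ge0 : 0 <= c.
Hypothesis card_W : #|W|%:R <= c * s ^+ d.-1 ^+ 2.
Hypothesis W_regular : forall m, m != 0 ->
  Normc.normc (fourier_indicator chi W m) <= c * (s ^+ d.+1)^-1.
Hypothesis th_gt0 : 0 < th.
Hypothesis th_le1 : th <= 1.
Hypothesis u_ge0 : 0 <= u.
Hypothesis aE : s ^+ d.-1 = u * n.
Hypothesis a_le_n : s ^+ d.-1 <= n.

Let normC (z : R[i]) : `|z| = (Normc.normc z)%:C.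
Proof. by []. Qed.

Lemma real_complex_moment_const (j : nat) :
  (moment_const c j)%:C = moment_const c%:C j.
Proof. by elim: j => [|j IH] //=; rewrite -IH; simpc. Qed.

(** Every quantity in [relative_error] is the image of a real number in [R[i]], and this embedding
    reflects the order. *)
Lemma relative_error_real :
  `|q * #|sum_solutions k Q E t|%:R - n ^+ k| <=
  5 * (c + (moment_const c k./2.-1 + moment_const c k./2)) *
    (th + th^-1 * (u + q * u ^+ k.-1)) * n ^+ k.
Proof.
have q0 : 0 < q by rewrite ltr0n ltnW // finNzRing_gt1.
have s0 : 0 < s by rewrite sqrtr_gt0.
have s_sq : s ^+ 2 = q by rewrite sqr_sqrtr // ltW.
have natC j : (j%:R : R)%:C = j%:R :> R[i] by rewrite rmorph_nat.
have XC (x : R) j : (x ^+ j)%:C = x%:C ^+ j by rewrite rmorphXn.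
have MC (x y : R) : (x * y)%:C = x%:C * y%:C by rewrite rmorphM.
have DC (x y : R) : (x + y)%:C = x%:C + y%:C by rewrite rmorphD.
have BC (x y : R) : (x - y)%:C = x%:C - y%:C by rewrite rmorphB.
have VC (x : R) : (x^-1)%:C = (x%:C)^-1 by rewrite fmorphV.
have [chi0 chiD chi1] := chiP.
have chiA : additive_character chi by [].
have a_gt0 : 0 < (s ^+ d.-1)%:C by rewrite ltcR exprn_gt0.
have a_sq : (#|F|%:R : R[i]) ^+ d = #|F|%:R * (s ^+ d.-1)%:C ^+ 2.
  rewrite -natC -!XC -MC; congr (_%:C); rewrite -/q -s_sq -!exprM -exprD.
  by rewrite -{1}(prednK d_gt0) mulnS [(d.-1 * 2)%N]mulnC.
have reg m : m != 0 -> `|exp_sum chi W m| <= c%:C * (s ^+ d.-1)%:C.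
  move=> m0; have := W_regular (m := - m); rewrite oppr_eq0 => /(_ m0).
  rewrite -lecR -normC.
  (* The sign in the Fourier transform is absorbed by evaluating at [- m]. *)
  have -> : fourier_indicator chi W (- m) = (#|F|%:R ^+ d)^-1 * exp_sum chi W m.
    rewrite /fourier_indicator; congr (_ * _); rewrite /exp_sum [RHS]big_mkcond /=.
    apply: eq_bigr => x _; rewrite dotpNl opprK.
    by case: ifP => _; rewrite ?mulr1 ?mulr0.
  have qd0 : 0 < (#|F|%:R : R[i]) ^+ d by rewrite exprn_gt0 // -natC ltcR.
  rewrite normrM normfV [`|_ ^+ d|]gtr0_norm // mulrC ler_pdivrMr //.
  move/le_trans; apply; rewrite -natC -XC -!MC lecR -mulrA ler_wpM2l //.
  rewrite -/q -s_sq -exprM le_eqVlt; apply/orP; left; apply/eqP.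
  have -> : (2 * d = d.+1 + d.-1)%N by rewrite addSnnS prednK // addnn mul2n.
  by rewrite exprD mulKf // expf_neq0 // gt_eqF.
have := @relative_error R[i] F d chi chiA chi1 c%:C (s ^+ d.-1)%:C E W EW _ a_gt0 _ reg a_sq _
  th%:C u%:C k _ _ k_ge3 _ _ Q t s%:C QP t0 _ _ d_gt0 _.
rewrite -!natC -!real_complex_moment_const -!(XC, MC, DC, BC, VC) !lecR ?ltcR ?ler0c.
have normcR (x : R) : Normc.normc x%:C = `|x| by rewrite /= expr0n /= addr0 sqrtr_sqr.
rewrite normcR -/q -/n => H; apply: H => //; [by rewrite aE | by rewrite s_sq].
Qed.

End Transfer.

(** * Real powers and the limit along prime powers *)

Lemma powR_half (R : realType) (x : R) (n : nat) :
  0 <= x -> x `^ (n%:R / 2) = Num.sqrt x ^+ n.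
Proof. by move=> x0; rewrite mulrC powRrM powR12_sqrt // powR_mulrn // sqrtr_ge0. Qed.

Lemma powR_root (R : realType) (x : R) (n : nat) :
  0 <= x -> (0 < n)%N -> (x `^ n%:R^-1) ^+ n = x.
Proof.
move=> x0 n0; rewrite -powR_mulrn ?powR_ge0 // -powRrM mulVf ?powRr1 //.
by rewrite pnatr_eq0 -lt0n.
Qed.

Theorem theorem1p4 (R : realType) (d k : nat) (hd : (1 <= d)%N) (hk : (3 <= k)%N)
    (F : nat -> finFieldType)
    (hF : forall q, prime_power q -> #|F q| = q)
    (chi : forall q, F q -> R[i])
    (hchi : forall q, prime_power q -> nontrivial_additive_character (chi q))
    (Q : forall q, 'rV[F q]_d -> F q)
    (hQ : forall q, prime_power q -> nondegenerate_quadratic_form (Q q))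
    (V : forall q, {set 'rV[F q]_d})
    (hV : regular_varieties chi V)
    (E : forall q, {set 'rV[F q]_d})
    (hEV : forall q, prime_power q -> E q \subset V q)
    (hE : (fun q : nat => q%:R `^ ((d%:R - 1) / 2 + (k%:R - 1)^-1) : R^o)
            =o_prime_power_oo (fun q : nat => #|E q|%:R : R^o))
    (t : forall q, F q)
    (ht : forall q, prime_power q -> t q != 0) :
  exists delta : nat -> R,
    (delta q @[q --> prime_power_oo] --> (0 : R))%classic /\
    forall q, prime_power q ->
      #|sum_solutions k (Q q) (E q) (t q)|%:R
        = (1 - delta q) * (#|E q|%:R ^+ k / q%:R) :> R.
Proof.
pose N q : R := #|sum_solutions k (Q q) (E q) (t q)|%:R.
pose n q : R := #|E q|%:R.
have q_gt0 q : prime_power q -> 0 < q%:R :> R.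
  by move=> [p [e [pp _ ->]]]; rewrite ltr0n expn_gt0 prime_gt0.
have k1 : k%:R - 1 = k.-1%:R :> R.
  by rewrite -[in LHS](prednK (ltnW (ltnW hk))) -natr1 addrK.
have d1 : d%:R - 1 = d.-1%:R :> R by rewrite -[in LHS](prednK hd) -natr1 addrK.
have k1_gt0 : (0 < k.-1)%N by lia.
exists (fun q => 1 - N q * q%:R / n q ^+ k); split; last first.
  move=> q qP; rewrite subKr -/(N q) -/(n q).
  (* If [E q] is empty, the right side is [0] because [k > 0], and there are no solutions. *)
  have [n0|n0] := eqVneq (n q) 0; last first.
    by field; rewrite gt_eqF ?q_gt0 // expf_neq0.
  rewrite n0 expr0n gtn_eqF ?(ltnW (ltnW hk)) // mul0r mulr0.
  apply/eqP; rewrite pnatr_eq0 cards_eq0; apply/eqP/setP => x.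
  rewrite !inE; apply/negbTE; rewrite negb_and; apply/orP; left.
  apply/forallPn; exists (Ordinal (ltnW (ltnW hk))).
  move: n0 => /eqP; rewrite /n pnatr_eq0 cards_eq0 => /eqP ->.
  by rewrite inE.
have [_ [C1 [C2 [C1_gt0 C2_gt0 cardV]]] [Cv Cv_gt0 fourV]] := hV.
pose c := C2 + Cv.
have c_gt0 : 0 < c by rewrite addr_gt0.
pose B := moment_const c k./2.-1 + moment_const c k./2.
have B_ge0 : 0 <= B by rewrite addr_ge0 // moment_const_ge0 // ltW.
(* [15 = 5 * 3]: the factor [5] of the relative error, and [Y <= 3 th]. *)
pose K := 15 * (c + B).
have K_gt0 : 0 < K by rewrite mulr_gt0 // (lt_le_trans c_gt0) // lerDl.
apply/cvgrPdist_le => eps eps_gt0.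
pose th := Num.min 1 (eps / K).
have th_gt0 : 0 < th by rewrite lt_min ltr01 divr_gt0.
have th_le1 : th <= 1 by rewrite ge_min lexx.
have th_eps : K * th <= eps.
  by rewrite mulrC -ler_pdivlMr // ge_min lexx orbT.
have th2_gt0 : 0 < th ^+ 2 by rewrite exprn_gt0.
(* The constant [th ^+ 2] is chosen so that [th^-1 * X] is still at most [2 th]. *)
have h : \forall q \near \oo%classic, prime_power q ->
    `|q%:R `^ ((d%:R - 1) / 2 + (k%:R - 1)^-1) : R^o| <= th ^+ 2 * `|n q : R^o|.
  by move/eqoP: hE => /(_ (th ^+ 2) th2_gt0).
suff : \forall q \near \oo%classic, prime_power q ->
    `|0 - (1 - N q * q%:R / n q ^+ k)| <= eps by [].
apply: filterS h => q + qP => /(_ qP).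
have q0 := q_gt0 q qP; have qF : #|F q| = q := hF q qP.
set s : R := Num.sqrt q%:R.
have s_sq : s ^+ 2 = q%:R by rewrite sqr_sqrtr // ltW.
have s_gt0 : 0 < s by rewrite sqrtr_gt0.
set v : R := q%:R `^ k.-1%:R^-1.
have v_k : v ^+ k.-1 = q%:R by rewrite powR_root // ltW.
have q_ge1 : 1 <= q%:R :> R by rewrite ler1n -(ltr0n R).
have v_ge1 : 1 <= v.
  by rewrite -(powRr0 q%:R) ler_powR // invr_ge0.
rewrite d1 k1 powRD; last by apply/implyP => _; rewrite gt_eqF.
rewrite powR_half ?(ltW q0) // -/s -/v.
set a : R := s ^+ d.-1.
have a_gt0 : 0 < a by rewrite exprn_gt0.
have av_gt0 : 0 < a * v by rewrite mulr_gt0 // (lt_le_trans ltr01).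
have -> : `|a * v : R^o| = a * v by rewrite ger0_norm // ltW.
have -> : `|n q : R^o| = n q by rewrite ger0_norm // ler0n.
move=> avn.
have n_gt0 : 0 < n q.
  by have := lt_le_trans av_gt0 avn; rewrite pmulr_rgt0.
set u := a / n q.
have u_ge0 : 0 <= u by rewrite divr_ge0 ?ltW.
have uv_le : u * v <= th ^+ 2 by rewrite mulrAC ler_pdivrMr.
have th2_le1 : th ^+ 2 <= 1 by rewrite exprn_ile1 // ltW.
have u_le : u <= th ^+ 2.
  by apply: (le_trans _ (uv_le)); rewrite ler_peMr.
have aE : a = u * n q by rewrite divfK // gt_eqF.
have a_le_n : a <= n q.
  by rewrite aE ler_piMl ?(ltW n_gt0) // (le_trans u_le).
(* [q u^(k-1) = (u v)^(k-1)] is at most [u v], because [u v <= 1] and [k - 1 >= 1]. *)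
have quk : q%:R * u ^+ k.-1 <= th ^+ 2.
  rewrite -v_k -exprMn mulrC; apply: (le_trans _ (uv_le)).
  have uv0 : 0 <= u * v by rewrite mulr_ge0 // (le_trans ler01).
  by rewrite -[leRHS]expr1 ler_wiXn2l // (le_trans uv_le).
have cardV' : #|V q|%:R <= c * s ^+ d.-1 ^+ 2.
  have /andP[_ /ltW h] := cardV q qP; apply: (le_trans h).
  rewrite d1 powR_mulrn ?(ltW q0) // -exprM mulnC exprM s_sq.
  by rewrite ler_wpM2r ?exprn_ge0 ?(ltW q0) // lerDl ltW.
have fourV' (m : 'rV[F q]_d) : m != 0 ->
    Normc.normc (fourier_indicator (chi q) (V q) m) <= c * (s ^+ d.+1)^-1.
  move=> /(fourV q qP) h; apply: (le_trans h).
  rewrite powRN natr1 powR_half ?(ltW q0) // ler_wpM2r ?invr_ge0 ?exprn_ge0 ?(ltW s_gt0) //.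
  by rewrite lerDr ltW.
have := @relative_error_real R (F q) d k (chi q) (Q q) (E q) (V q) (t q) c th u
  (hchi q qP) (hQ q qP) (ht q qP) hd hk (hEV q qP) (ltW c_gt0).
rewrite qF -/s -/a -/(n q) -/(N q) -/B.
move=> /(_ cardV' fourV' th_gt0 th_le1 u_ge0 aE a_le_n) err.
have nk_gt0 : 0 < n q ^+ k by rewrite exprn_gt0.
have -> : 0 - (1 - N q * q%:R / n q ^+ k) = (q%:R * N q - n q ^+ k) / n q ^+ k.
  by field; rewrite gt_eqF.
rewrite normrM normfV [`|n q ^+ k|]gtr0_norm // ler_pdivrMr //.
apply: (le_trans err); rewrite ler_wpM2r ?(ltW nk_gt0) //.
apply: le_trans th_eps; rewrite /K.
have -> : 15 * (c + B) * th = 5 * (c + B) * (3 * th) by ring.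
apply: ler_wpM2l; first exact: mulr_ge0 (ler0n _ _) (addr_ge0 (ltW c_gt0) B_ge0).
have hX : th^-1 * (u + q%:R * u ^+ k.-1) <= th^-1 * (th ^+ 2 + th ^+ 2).
  by rewrite ler_wpM2l ?invr_ge0 ?(ltW th_gt0) // lerD.
have e : th^-1 * (th ^+ 2 + th ^+ 2) = 2 * th by field; rewrite gt_eqF.
by rewrite e in hX; lra.
Qed.
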